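(* Let $G_m$ be a bounded Vilenkin group, $R:=\sup_{k\in\mathbb{N}}m_k<\infty$, let $t_n$ be the Nörlund means generated by a non-increasing sequence $\{q_k:k\in\mathbb{N}\}$ (of nonnegative numbers with $q_0>0$ and $Q_n\to\infty$), and let $1\le p<\infty$. Then there is a constant $C>0$, independent of $n$ and $f$, such that for every $f\in L^p(G_m)$ and every $n\in\mathbb{N}$, $$\Vert t_{M_n}f-f\Vert_p\le 3R^2\sum_{s=0}^{n}\frac{M_s}{M_n}\,\omega_p\left(\frac{1}{M_s},f\right)+C\sum_{s=0}^{n-1}\frac{(n-s)M_s}{M_n}\,\frac{q_{M_s}}{q_{M_n}}\,\omega_p\left(\frac{1}{M_s},f\right).$$
   Context: $\mathbb{N}_+$ is the set of positive integers and $\mathbb{N}=\mathbb{N}_+\cup\{0\}$. Let $m=(m_0,m_1,\dots)$ be a sequence of integers $\ge 2$ with $R:=\sup_k m_k<\infty$ (bounded case). $Z_{m_k}=\{0,1,\dots,m_k-1\}$ is the additive group of integers modulo $m_k$, and $G_m=\prod_{k\ge0}Z_{m_k}$ is the complete direct product with the product of the discrete topologies; elements are $x=(x_0,x_1,\dots)$ with $x_k\in Z_{m_k}$. The Haar measure $\mu$ on $G_m$, with $\mu(G_m)=1$, is the product of the uniform measures $\mu_k(\{j\})=1/m_k$. Put $M_0=1$, $M_{k+1}=m_kM_k$. Every $n\in\mathbb{N}$ is uniquely $n=\sum_{j\ge0}n_jM_j$ with $n_j\in Z_{m_j}$, only finitely many nonzero. Generalized Rademacher functions: $r_k(x)=\exp(2\pi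 i x_k/m_k)$. Vilenkin system: $\psi_n(x)=\prod_{k\ge0}r_k(x)^{n_k}$, $n\in\mathbb{N}$. For $f\in L^1(G_m)$: $\widehat f(k)=\int_{G_m}f\,\overline{\psi_k}\,d\mu$, $S_nf=\sum_{k=0}^{n-1}\widehat f(k)\psi_k$ ($n\in\mathbb{N}_+$), $S_0f=0$. $\Vert f\Vert_p=(\int_{G_m}|f|^p\,d\mu)^{1/p}$. Nörlund means: for a sequence $\{q_k:k\ge0\}$ of nonnegative numbers with $q_0>0$, put $Q_n=\sum_{k=0}^{n-1}q_k$ and assume $\lim_{n\to\infty}Q_n=\infty$; then $t_nf=\frac{1}{Q_n}\sum_{k=1}^{n}q_{n-k}S_kf$ for $n\in\mathbb{N}_+$. (If $\{q_k\}$ is non-increasing, $Q_n\to\infty$ forces all $q_k>0$, and the method is automatically regular, i.e. $q_{n-1}/Q_n\to0$.) Modulus of continuity: $\omega_p(\delta,f)=\sup_{|t|<\delta}\Vert f(\cdot+t)-f(\cdot)\Vert_p$ for $\delta>0$, where $+$ is the group operation of $G_m$ and $|t|=\sum_{k\ge0}t_k/M_{k+1}$ for $t=(t_0,t_1,\dots)\in G_m$. *)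

(* Defs.v *)
From HB Require Import structures.
From mathcomp Require Import all_boot all_order all_algebra.
From mathcomp Require Import all_classical all_reals all_analysis.
From mathcomp Require Import measurable_realfun complex.

Set Implicit Arguments.
Unset Strict Implicit.
Unset Printing Implicit Defensive.

Import Order.TTheory GRing.Theory Num.Theory.
Import numFieldNormedType.Exports.

Local Open Scope classical_set_scope.
Local Open Scope complex_scope.
Local Open Scope ring_scope.

(* ['Z_n] is Z/nZ only for n >= 2, so this is the intended group only when
   every [m k] is at least 2. *)
Definition vilenkin (m : nat -> nat) := forall k, 'Z_(m k).

Section vilenkin_group.
Variable m : nat -> nat.
Implicit Types x y z : vilenkin m.

Let add x y : vilenkin m := fun k => x k + y k.
Let opp x : vilenkin m := fun k => - x k.
Let zero : vilenkin m := fun=> 0.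

Let addA : associative add.
Proof. by move=> x y z; apply: functional_extensionality_dep => k; exact: addrA. Qed.
Let addC : commutative add.
Proof. by move=> x y; apply: functional_extensionality_dep => k; exact: addrC. Qed.
Let add0 : left_id zero add.
Proof. by move=> x; apply: functional_extensionality_dep => k; exact: add0r. Qed.
Let addN : left_inverse zero opp add.
Proof. by move=> x; apply: functional_extensionality_dep => k; exact: addNr. Qed.

HB.instance Definition _ := gen_eqMixin (vilenkin m).
HB.instance Definition _ := gen_choiceMixin (vilenkin m).
HB.instance Definition _ := GRing.isZmodule.Build (vilenkin m) addA addC add0 addN.
HB.instance Definition _ := isPointed.Build (vilenkin m) 0.

End vilenkin_group.

(* There are countably many finite factors, so the sigma-algebra generated by
   these sets is the Borel sigma-algebra of the product topology. *)
Definition coord_cylinders (m : nat -> nat) : set (set (vilenkin m)) :=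
  [set C | exists k (j : 'Z_(m k)), C = [set x | x k = j]].

HB.instance Definition _ (m : nat -> nat) :=
  Measurable.copy (vilenkin m) (g_sigma_algebraType (@coord_cylinders m)).

Definition Mprod (m : nat -> nat) (k : nat) : nat := (\prod_(j < k) m j)%N.

Lemma Mprod_gt0 (m : nat -> nat) (m_ge2 : forall k, (2 <= m k)%N) k :
  (0 < Mprod m k)%N.
Proof. by apply: prodn_gt0 => j; exact: ltn_trans (m_ge2 j). Qed.

Lemma MprodS (m : nat -> nat) k : Mprod m k.+1 = (Mprod m k * m k)%N.
Proof. by rewrite /Mprod big_ord_recr. Qed.

(* The digit n_j in n = sum_j n_j M_j, 0 <= n_j < m_j; see [digit_expansion]. *)
Definition digit (m : nat -> nat) (n j : nat) : nat :=
  ((n %/ Mprod m j) %% m j)%N.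

Lemma digit_expansion (m : nat -> nat) n k :
  (n < Mprod m k)%N -> n = (\sum_(j < k) digit m n j * Mprod m j)%N.
Proof.
move=> nk; rewrite -[LHS](modn_small nk) {nk}.
elim: k => [|k IH]; first by rewrite /Mprod !big_ord0 modn1.
rewrite big_ord_recr/= -IH MprodS /digit modn_divl (mulnC (m k)).
rewrite -(modn_dvdm n (dvdn_mulr (m k) (dvdnn (Mprod m k)))) addnC.
exact: divn_eq.
Qed.

(* The product of the uniform measures mu_k({j}) = 1 / m k, i.e. the
   normalized Haar measure.  Rectangles depending on finitely many coordinates
   form a generating pi-system, so this determines mu; existence is
   [haar_exists] below. *)
Definition is_haar (R : realType) (m : nat -> nat)
    (mu : probability (vilenkin m) R) :=
  forall (n : nat) (A : forall k, {set 'Z_(m k)}),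
    mu [set x | forall k, (k < n)%N -> x k \in A k] =
    (\prod_(k < n) (#|A k|%:R / (m k)%:R))%:E.

Section haar_exists.
Variables (R : realType) (m : nat -> nat).

(* The base-m digits of a real number: the Haar measure is the image under
   this map of the uniform probability on the unit interval. *)
Let rdigits (x : R) : vilenkin m :=
  fun k => inZp (Num.truncn (x * (Mprod m k.+1)%:R)).

Let measurable_truncn_le (M N : nat) :
  measurable [set x : measurableTypeR R | (Num.truncn (x * M%:R) <= N)%N].
Proof.
have mf : measurable_fun setT (fun x : measurableTypeR R => x * M%:R).
  exact: measurable_funM.
have -> : [set x : measurableTypeR R | (Num.truncn (x * M%:R) <= N)%N] =
    setT `&` (fun x => x * M%:R) @^-1` `]-oo, N.+1%:R[%classic.
  by apply/seteqP; split => x /=; rewrite truncn_le_nat in_itv//= => -[].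
exact: mf.
Qed.

Let measurable_truncn_eq (M N : nat) :
  measurable [set x : measurableTypeR R | Num.truncn (x * M%:R) = N].
Proof.
have -> : [set x : measurableTypeR R | Num.truncn (x * M%:R) = N] =
    [set x : measurableTypeR R | (Num.truncn (x * M%:R) <= N)%N] `\`
    (if N is N'.+1 then
       [set x : measurableTypeR R | (Num.truncn (x * M%:R) <= N')%N] else set0).
  apply/seteqP; case: N => [|N]; split => x /=.
  - by move=> ->; split.
  - by rewrite leqn0 => -[/eqP].
  - by move=> ->; split => //; rewrite ltnn.
  - by case=> h /negP; rewrite -ltnNge => h'; apply/eqP; rewrite eqn_leq h.
by apply: measurableD => //; case: N.
Qed.

Let measurable_rdigits :
  measurable_fun setT (rdigits : measurableTypeR R -> vilenkin m).
Proof.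
apply: (measurability (coord_cylinders (m := m))) => // _ [_ [k [j ->]] <-].
rewrite setTI.
have -> : rdigits @^-1` [set x | x k = j] =
    \bigcup_(N in [set N | inZp N = j])
      [set x | Num.truncn (x * (Mprod m k.+1)%:R) = N].
  apply/seteqP; split => [x /= xj|x [N /= Nj xN]]; last by rewrite /rdigits/= xN.
  by exists (Num.truncn (x * (Mprod m k.+1)%:R)).
by apply: bigcup_measurable => N _; exact: measurable_truncn_eq.
Qed.

Let rdigits_mfun : {mfun measurableTypeR R >-> vilenkin m} :=
  @mfun_Sub _ _ (measurableTypeR R) (vilenkin m) rdigits (mem_set measurable_rdigits).

Hypothesis m_ge2 : forall k, (2 <= m k)%N.

Let m_gt0 k : (0 < m k)%N. Proof. exact: ltn_trans (m_ge2 k). Qed.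

Let Zp_m k : (Zp_trunc (m k)).+2 = m k.
Proof. exact: Zp_cast. Qed.

Let idx (a : vilenkin m) := fix idx n : nat :=
  if n is k.+1 then (idx k * m k + a k)%N else 0%N.

Let idx_lt a n : (idx a n < Mprod m n)%N.
Proof.
elim: n => [|n IH]; first by rewrite /Mprod big_ord0.
have an : (a n < m n)%N by rewrite -[X in (_ < X)%N]Zp_m ltn_ord.
rewrite MprodS /= -addnS; apply: (@leq_trans ((idx a n).+1 * m n)).
  by rewrite mulSn addnC leq_add2r.
by rewrite leq_mul2r IH orbT.
Qed.

Let truncn_mulS (y : R) k : 0 <= y ->
  (Num.truncn (y * k.+1%:R) %/ k.+1)%N = Num.truncn y.
Proof.
move=> y0; apply/esym/truncn_def.
have /andP[h1 h2] := truncn_itv (mulr_ge0 y0 (ler0n R k.+1)).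
set N := Num.truncn (y * k.+1%:R) in h1 h2 *.
have k0 : 0 < k.+1%:R :> R by rewrite ltr0n.
apply/andP; split.
  rewrite -(ler_pM2r k0) (le_trans _ h1)// -natrM ler_nat.
  exact: leq_divM.
rewrite -(ltr_pM2r k0) (lt_le_trans h2)// -natrM ler_nat.
exact: ltn_ceil.
Qed.

Let rdigits_idx (x : R) a n : 0 <= x < 1 ->
  (forall k, (k < n)%N -> rdigits x k = a k) <->
  Num.truncn (x * (Mprod m n)%:R) = idx a n.
Proof.
move=> /andP[x0 x1]; elim: n => [|n IH].
  rewrite /Mprod big_ord0 mulr1 /=; split => // _.
  by apply: truncn_def; rewrite x0.
have an : (a n < m n)%N by rewrite -[X in (_ < X)%N]Zp_m ltn_ord.
set T := Num.truncn (x * (Mprod m n.+1)%:R).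
have Tdiv : (T %/ m n)%N = Num.truncn (x * (Mprod m n)%:R).
  rewrite /T MprodS natrM mulrA.
  by case: (m n) (m_gt0 n) => // k _; apply: truncn_mulS; exact: mulr_ge0.
have Tmod : rdigits x n = a n <-> (T %% m n)%N = a n.
  have vE : nat_of_ord (rdigits x n) = (T %% m n)%N.
    by rewrite /rdigits/= -/T Zp_m.
  by rewrite -vE; split => [-> //|h]; exact: val_inj.
split => [h|/= TE].
  have /IH h1 : forall k, (k < n)%N -> rdigits x k = a k.
    by move=> k kn; apply: h; exact: ltnW.
  have /Tmod h2 := h n (ltnSn n).
  by rewrite (divn_eq T (m n)) Tdiv h1 h2.
have h1 : Num.truncn (x * (Mprod m n)%:R) = idx a n.
  by rewrite -Tdiv TE divnMDl// divn_small// addn0.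
have h2 : rdigits x n = a n by apply/Tmod; rewrite TE modnMDl modn_small.
move=> k; rewrite ltnS leq_eqVlt => /orP[/eqP ->//|].
exact: (iffRL IH h1).
Qed.

Let haar : probability (vilenkin m) R :=
  distribution (uniform_prob (@ltr01 R)) rdigits_mfun.

Let measurable_coord k (B : {set 'Z_(m k)}) :
  measurable [set x : vilenkin m | x k \in B].
Proof.
have -> : [set x : vilenkin m | x k \in B] =
    \bigcup_(j in [set j | j \in B]) [set x : vilenkin m | x k = j].
  by apply/seteqP; split => [x /= xB|x [j /= jB xj]]; [exists (x k)|rewrite xj].
apply: fin_bigcup_measurable; first exact: finite_finset.
by move=> j _; apply: sub_sigma_algebra; exists k, j.
Qed.

Let measurable_rect n (A : forall k, {set 'Z_(m k)}) :
  measurable [set x : vilenkin m | forall k, (k < n)%N -> x k \in A k].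
Proof.
elim: n => [|n IH].
  by rewrite [X in measurable X](_ : _ = setT)//; apply/seteqP; split.
rewrite [X in measurable X](_ : _ =
    [set x : vilenkin m | forall k, (k < n)%N -> x k \in A k] `&`
    [set x | x n \in A n]); first exact: measurableI IH (measurable_coord (A n)).
apply/seteqP; split => x /=.
  by move=> h; split => [k kn|]; apply: h => //; exact: ltnW.
by case=> h hn k; rewrite ltnS leq_eqVlt => /orP[/eqP ->//|/h].
Qed.

Let haar_cylinder a n :
  haar [set x | forall k, (k < n)%N -> x k \in [set a k]%SET] =
  ((Mprod m n)%:R^-1)%:E.
Proof.
have M0 : 0 < (Mprod m n)%:R :> R by rewrite ltr0n Mprod_gt0.
set S := [set x | _].
pose I : set R := `[(idx a n)%:R / (Mprod m n)%:R, (idx a n).+1%:R / (Mprod m n)%:R[%classic.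
have mS : measurable (rdigits @^-1` S : set (measurableTypeR R)).
  rewrite -[X in measurable X]setTI; apply: measurable_rdigits => //.
  exact: (measurable_rect n (fun k => [set a k]%SET)).
have SI x : 0 <= x < 1 -> S (rdigits x) <-> I x.
  move=> x01; rewrite /I/= in_itv/= ler_pdivrMr// ltr_pdivlMr//.
  have -> : (idx a n)%:R <= x * (Mprod m n)%:R < (idx a n).+1%:R <->
      Num.truncn (x * (Mprod m n)%:R) = idx a n.
    have xM : 0 <= x * (Mprod m n)%:R by case/andP: x01 => x0 _; exact: mulr_ge0.
    by split => [/truncn_def//|<-]; exact: truncn_itv.
  rewrite -rdigits_idx// /S/=.
  by split => h k /h; [rewrite inE => /eqP|move=> ->; rewrite inE].
have mI : measurable (I : set (measurableTypeR R)) by exact: measurable_itv.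
have m1 : measurable (rdigits @^-1` S `&` [set 1] : set (measurableTypeR R)).
  by apply: measurableI => //; exact: measurable_set1.
have SE : rdigits @^-1` S `&` `[0, 1] = I `|` (rdigits @^-1` S `&` [set 1]).
  apply/seteqP; split => [x [Sx]|x [Ix|[Sx x1]]].
  - rewrite /= in_itv/= => /andP[x0]; rewrite le_eqVlt => /orP[/eqP x1|x1].
      by right.
    by left; apply/SI => //; rewrite x0.
  - have x01 : 0 <= x < 1.
      move: Ix; rewrite /I/= in_itv/= => /andP[Ix1 Ix2].
      rewrite (le_trans _ Ix1) ?divr_ge0//= (lt_le_trans Ix2)//.
      by rewrite ler_pdivrMr// mul1r ler_nat idx_lt.
    split; first by apply/SI.
    by rewrite /= in_itv/=; case/andP: x01 => -> /ltW.
  - by split => //; rewrite x1 /= in_itv/= ler01 lexx.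
transitivity (uniform_prob (@ltr01 R) (rdigits @^-1` S)); first by [].
rewrite /uniform_prob integral_uniform_pdf SE.
rewrite (eq_integral (fun=> 1%E)); last first.
  move=> x; rewrite -SE inE => -[_]; rewrite /= in_itv/= /uniform_pdf => ->.
  by rewrite subr0 invr1.
rewrite integral_cst ?mul1e; last exact: measurableU.
transitivity (lebesgue_measure I).
  apply: measureU0 => //.
  apply/eqP; rewrite eq_le measure_ge0 andbT -(lebesgue_measure_set1 (1 : R)).
  by apply: le_measure; rewrite ?inE//; exact: measurable_set1.
rewrite /I lebesgue_measure_itv/= lte_fin ltr_pM2r ?invr_gt0// ltr_nat ltnSn.
by rewrite -EFinB -mulrBl -natrB// subSnn mul1r.
Qed.

Let haar_rect n : forall i, (i <= n)%N ->
  forall (A : forall k, {set 'Z_(m k)}) (a : vilenkin m),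
  haar [set x | (forall k, (k < i)%N -> x k \in A k) /\
                (forall k, (i <= k < n)%N -> x k = a k)] =
  (\prod_(k < i) #|A k|%:R / (Mprod m n)%:R)%:E.
Proof.
elim => [_ A a|i IH lin A a].
  rewrite big_ord0 mul1r -(haar_cylinder a n); congr (haar _).
  apply/seteqP; split => [x /= [_ h] k kn|x /= h]; first by rewrite h// inE.
  by split => // k kn; have := h _ kn; rewrite inE => /eqP.
pose upd (j : 'Z_(m i)) : vilenkin m := @dfwith nat (fun k => 'Z_(m k)) a i j.
pose F (j : 'Z_(m i)) : set (vilenkin m) := [set x | (forall k, (k < i)%N -> x k \in A k) /\
                (forall k, (i <= k < n)%N -> x k = upd j k)].
have updi j : upd j i = j by rewrite /upd dfwithin.
have updk j k : (i < k)%N -> upd j k = a k.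
  by move=> ik; rewrite /upd dfwithout// ltn_eqF.
have mF j : measurable (F j).
  rewrite [X in measurable X](_ : _ = [set x : vilenkin m | forall k, (k < n)%N ->
    x k \in (if (k < i)%N then A k else [set upd j k])%SET]) //.
  apply/seteqP; split => x /=.
    move=> [h1 h2] k kn; case: ltnP => ki; first exact: h1.
    by rewrite h2 ?ki// inE.
  move=> h; split => k.
    by move=> ki; have := h k (ltn_trans ki lin); rewrite ki.
  by move=> /andP[ik kn]; have := h k kn; rewrite ltnNge ik/= inE => /eqP.
have -> : [set x : vilenkin m | (forall k, (k < i.+1)%N -> x k \in A k) /\
      (forall k, (i.+1 <= k < n)%N -> x k = a k)] =
    \bigcup_(j in [set` enum (A i)]) F j.
  apply/seteqP; split => [x /= [h1 h2]|x [j /=]].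
    exists (x i); first by rewrite /= mem_enum h1.
    split => [k ki|k /andP[]]; first by apply: h1; exact: ltnW.
    rewrite leq_eqVlt => /orP[/eqP <- _|ik kn]; first by rewrite updi.
    by rewrite updk// h2// ik.
  rewrite mem_enum => jA [h1 h2]; split => k.
    rewrite ltnS leq_eqVlt => /orP[/eqP ->|]; last exact: h1.
    by rewrite h2 ?leqnn// updi.
  by move=> /andP[ik kn]; rewrite h2 ?updk// (ltnW ik).
rewrite measure_fin_bigcup//=; first last.
- apply/trivIsetP => j j' _ _ jj'; apply/seteqP; split => // x [[_ h] [_ h']].
  move: jj'; rewrite -(updi j) -(updi j') -h ?leqnn//.
  by rewrite -h' ?leqnn// eqxx.
rewrite -fsbig_seq ?enum_uniq//=.
rewrite (eq_bigr (fun=> (\prod_(k < i) #|A k|%:R / (Mprod m n)%:R)%:E)); last first.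
  by move=> j _; exact: (IH (ltnW lin) A (upd j)).
rewrite sumEFin big_enum/= sumr_const big_ord_recr/=; congr (_%:E).
by rewrite -[LHS]mulr_natr mulrAC.
Qed.

Lemma haar_exists : exists mu : probability (vilenkin m) R, is_haar mu.
Proof.
exists haar => n A.
have := haar_rect (leqnn n) A 0.
rewrite [X in haar X](_ : _ =
  [set x : vilenkin m | forall k, (k < n)%N -> x k \in A k]) => [->|].
  by rewrite prodf_div /Mprod natr_prod.
apply/seteqP; split => [x /= []//|x /= h]; split => // k.
by move=> /andP[nk]; rewrite ltnNge nk.
Qed.

End haar_exists.
Section vilenkin_fourier.
Variables (R : realType) (m : nat -> nat).
Implicit Types (f : vilenkin m -> R[i]) (x t : vilenkin m).

Definition expi (t : R) : R[i] := Complex (cos t) (sin t).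

Definition rademacher (k : nat) x : R[i] :=
  expi (2 * pi * (nat_of_ord (x k))%:R / (m k)%:R).

(* As m >= 2, M_k > k, so the digits of n of index k >= n vanish and the
   infinite product reduces to its first n factors. *)
Definition psi (n : nat) x : R[i] :=
  \prod_(k < n) rademacher k x ^+ digit m n k.

Variable mu : probability (vilenkin m) R.

Definition cintegral f : R[i] :=
  Complex (\int[mu]_x complex.Re (f x)) (\int[mu]_x complex.Im (f x)).

Definition fourier_coef f (k : nat) : R[i] :=
  cintegral (fun x => f x * (psi k x)^*).

Definition partial_sum (n : nat) f x : R[i] :=
  \sum_(k < n) fourier_coef f k * psi k x.

Definition Qsum (q : R^nat) (n : nat) : R := \sum_(0 <= k < n) q k.

Definition norlund (q : R^nat) (n : nat) f x : R[i] :=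
  (Qsum q n)^-1%:C *
  \sum_(1 <= k < n.+1) (q (n - k)%N)%:C * partial_sum k f x.

Definition Lpnorm (p : R) f : \bar R :=
  Lnorm mu p%:E (fun x => (Normc.normc (f x))%:E).

(* Functions rather than classes modulo null sets. *)
Definition inLp (p : R) f :=
  [/\ measurable_fun setT (fun x => complex.Re (f x)),
      measurable_fun setT (fun x => complex.Im (f x)) &
      (Lpnorm p f < +oo)%E].

(* A series of nonnegative terms, summed in the extended reals; its value is
   at most 1 when every m k >= 2. *)
Definition vabs t : \bar R :=
  (\sum_(0 <= k <oo) ((nat_of_ord (t k))%:R / (Mprod m k.+1)%:R)%:E)%E.

Definition omega (p delta : R) f : \bar R :=
  ereal_sup [set Lpnorm p (fun x => f (x + t) - f x) |
             t in [set t | (vabs t < delta%:E)%E]].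

End vilenkin_fourier.

(* Main.v *)
(** Write I_s for the subgroup of those t whose first s coordinates vanish and
    K for the kernel with Q_N (t_N f - f)(x) = int (f(x + t) - f(x)) conj(K(t)) dt,
    where N = M_n and K = sum_(j < N) q_j D_(N - j).  The ball I_n contributes at
    most omega_p(1 / M_n, f), up to a constant factor, because |K| <= N Q_N.
    Off I_n the kernel D_N vanishes, so |D_(N - j)| <= j, and if the first two
    nonzero coordinates of t have indices s < r then all partial sums of the
    Dirichlet kernels at t are O(M_s M_r).  Summation by parts in j >= M_s gives
      |K(t)| <= sum_(j < M_s) j q_j + O(q_(M_s) M_s M_r);
    such t form a set of measure O(1 / M_r), and r takes n - s values, which is
    where the factor n - s comes from.  The sum over j < M_s is absorbed through
    sum_(j < M_s) j q_j = O(sum_(v < s) M_v^2 q_(M_v)) and the geometric growth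
    of M.  Every term with s < n of the first sum of the theorem is dominated by
    the corresponding term of the second, so only the summand s = n needs an
    explicit constant, and 2 <= 3 R^2 is available. *)
Require Import Defs.
From mathcomp Require Import all_boot all_order all_algebra.
From mathcomp Require Import all_classical all_reals all_analysis.
From mathcomp Require Import measurable_realfun complex ring lra zify.

Import Order.TTheory GRing.Theory Num.Theory.
Import numFieldNormedType.Exports.

Set Implicit Arguments.
Unset Strict Implicit.
Unset Printing Implicit Defensive.

Local Open Scope classical_set_scope.
Local Open Scope complex_scope.
Local Open Scope ring_scope.

(** * Characters and Dirichlet kernels *)

Section characters.
Variable R : realType.
Implicit Types a b : R.

Lemma expiD a b : expi (a + b) = expi a * expi b.
Proof. by apply/eqP; rewrite eq_complex /= cosD sinD eqxx/= addrC. Qed.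

Lemma expi0 : expi 0 = 1 :> R[i].
Proof. by rewrite /expi cos0 sin0. Qed.

Lemma expi_natmul a n : expi (n%:R * a) = expi a ^+ n.
Proof.
elim: n => [|n IH]; first by rewrite mul0r expi0 expr0.
by rewrite -natr1 mulrDl mul1r expiD IH exprSr.
Qed.

Lemma expi_2pi : expi (2 * pi) = 1 :> R[i].
Proof. by rewrite /expi mulr_natl cos2pi sin2pi. Qed.

Lemma norm_expi a : `|expi a| = 1.
Proof. by rewrite normc_def /= cos2Dsin2 sqrtr1. Qed.

(** The angle is doubled so that the real part is 2 cos^2 a - 1, which is below 1 because sin a >
    0. *)
Lemma expi_neq1 a : 0 < a < pi -> expi (2 * a) != 1.
Proof.
move=> /sin_gt0_pi a0; rewrite eq_complex /= mulr_natl cos_mulr2n negb_and.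
have := cos2Dsin2 a; move: (sin a) (cos a) a0 => s c s0 cs.
rewrite lt_eqF//; have : 0 < s ^+ 2 by rewrite exprn_gt0.
by rewrite -cs; lra.
Qed.

Variable m : nat -> nat.
Hypothesis m_ge2 : forall k, (2 <= m k)%N.
Implicit Types x y t : vilenkin m.

Let m_gt0 k : (0 < m k)%N. Proof. exact: ltn_trans (m_ge2 k). Qed.

Lemma coord_lt x k : (x k < m k)%N.
Proof. by rewrite -[X in (_ < X)%N]Zp_cast. Qed.

Lemma coord_neq0 x k : (x k != 0) = (0 < x k)%N.
Proof. by rewrite lt0n. Qed.

Let root k := expi (2 * pi / (m k)%:R) : R[i].

Let rootXm k : root k ^+ m k = 1.
Proof. by rewrite -expi_natmul mulrC divfK ?pnatr_eq0 -?lt0n// expi_2pi. Qed.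

Let rootX_mod k n : root k ^+ (n %% m k) = root k ^+ n.
Proof. by rewrite [in RHS](divn_eq n (m k)) exprD mulnC exprM rootXm expr1n mul1r. Qed.

Lemma rademacherE k x : rademacher R k x = root k ^+ x k.
Proof. by rewrite -expi_natmul mulrCA mulrA. Qed.

(** Coordinates add modulo [m k], and the base of the powers is an [m k]-th root of unity, so the
    reduction is invisible. *)
Lemma rademacherD k x y : rademacher R k (x + y) = rademacher R k x * rademacher R k y.
Proof.
rewrite !rademacherE -exprD -rootX_mod -[RHS]rootX_mod; congr (_ ^+ _).
have -> : nat_of_ord ((x + y) k) = ((x k + y k) %% (Zp_trunc (m k)).+2)%N by [].
by move: (nat_of_ord (x k)) (nat_of_ord (y k)) => a b; rewrite Zp_cast// modn_mod.
Qed.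

Lemma rademacher0 k x : x k = 0 -> rademacher R k x = 1.
Proof. by move=> xk; rewrite rademacherE xk expr0. Qed.

Lemma rademacherXm k x : rademacher R k x ^+ m k = 1.
Proof. by rewrite rademacherE exprAC rootXm expr1n. Qed.

Lemma norm_rademacher k x : `|rademacher R k x| = 1.
Proof. exact: norm_expi. Qed.

Lemma root_neq1 k n : (0 < n < m k)%N -> root k ^+ n != 1.
Proof.
move=> /andP[n0 nm]; rewrite -expi_natmul.
(* Half the angle, n pi / m_k, lies strictly between 0 and pi. *)
rewrite (_ : _ * _ = 2 * (n%:R * pi / (m k)%:R)); last by rewrite -2!mulrA mulrCA.
apply: expi_neq1; rewrite divr_gt0 ?mulr_gt0 ?ltr0n ?pi_gt0//=.
by rewrite ltr_pdivrMr ?ltr0n// mulrC ltr_pM2l ?pi_gt0// ltr_nat.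
Qed.

Lemma rademacher_neq1 k x : x k != 0 -> rademacher R k x != 1.
Proof. by move=> xk; rewrite rademacherE root_neq1// -coord_neq0 xk coord_lt. Qed.

Lemma leq_Mprod k l : (k <= l)%N -> (Mprod m k <= Mprod m l)%N.
Proof.
move=> /subnK <-; elim: (l - k)%N => // n IH.
by rewrite addSn MprodS (leq_trans IH)// leq_pmulr.
Qed.

Lemma ltn_Mprod n : (n < Mprod m n)%N.
Proof.
elim: n => [|n IH]; first by rewrite /Mprod big_ord0.
rewrite MprodS (leq_trans _ (leq_mul IH (m_ge2 n)))//.
by lia.
Qed.

Lemma dvdn_Mprod k l : (k <= l)%N -> (Mprod m k %| Mprod m l)%N.
Proof.
move=> /subnK <-; elim: (l - k)%N => // n IH.
by rewrite addSn MprodS dvdn_mulr.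
Qed.

Lemma digit_ge n k : (n < Mprod m k)%N -> digit m n k = 0%N.
Proof. by move=> nk; rewrite /digit divn_small// mod0n. Qed.

(** The number of factors in [psi] depends on n. As digits at k with M_k > n vanish, any long enough
    range will do, and characters of different index can be compared over a common one. *)
Lemma psi_prod N n x : (n < Mprod m N)%N ->
  psi R n x = \prod_(k < N) rademacher R k x ^+ digit m n k.
Proof.
have widen A B : (n < Mprod m A)%N -> (A <= B)%N ->
    \prod_(k < B) rademacher R k x ^+ digit m n k =
    \prod_(k < A) rademacher R k x ^+ digit m n k.
  move=> nA /subnK <-; elim: (B - A)%N => // C IH.
  rewrite addSn big_ord_recr /= IH digit_ge ?expr0 ?mulr1//.
  by rewrite (leq_trans nA)// leq_Mprod// leq_addl.
move=> nN; rewrite /psi; case: (leqP n N) => nN'.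
  by rewrite (widen n N)// ltn_Mprod.
by rewrite (widen N n)// ltnW.
Qed.

Lemma psiD n x y : psi R n (x + y) = psi R n x * psi R n y.
Proof.
by rewrite -big_split; apply: eq_bigr => k _ /=; rewrite rademacherD exprMn.
Qed.

Lemma norm_psi n x : `|psi R n x| = 1.
Proof.
rewrite normr_prod big1// => k _.
by rewrite normrX norm_rademacher expr1n.
Qed.

Lemma psi0 x : psi R 0 x = 1.
Proof. by rewrite /psi big_ord0. Qed.

(** M_(i+1) divides M_k, so after division by M_i the added term is a multiple of m_i. *)
Lemma digitMD_low j l k i : (i < k)%N ->
  digit m (j + l * Mprod m k) i = digit m j i.
Proof.
move=> ik; have /dvdnP[c ->] := dvdn_Mprod ik; rewrite /digit MprodS.
by rewrite [(Mprod _ _ * _)%N]mulnC !mulnA addnC divnMDl ?Mprod_gt0// modnMDl.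
Qed.

Lemma digitM_low l k i : (i < k)%N -> digit m (l * Mprod m k) i = 0%N.
Proof. by move=> ik; rewrite -[(l * _)%N]add0n digitMD_low// digit_ge// Mprod_gt0. Qed.

(** M_i is a multiple of M_k, and dividing by M_k first discards j. *)
Lemma digitMD_high j l k i : (j < Mprod m k)%N -> (k <= i)%N ->
  digit m (j + l * Mprod m k) i = digit m (l * Mprod m k) i.
Proof.
move=> jk ki; have /dvdnP[c cE] := dvdn_Mprod ki.
rewrite /digit cE mulnC [(c * _)%N]mulnC !divnMA mulKn ?Mprod_gt0//.
by rewrite addnC [(_ * l)%N]mulnC divnMDl ?Mprod_gt0// (divn_small jk) addn0.
Qed.

(** No carry occurs: j has its digits below k, and l M_k has its digits from k on. *)
Lemma psi_split j l k x : (j < Mprod m k)%N ->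
  psi R (j + l * Mprod m k) x = psi R j x * psi R (l * Mprod m k) x.
Proof.
(* N is a common number of factors for the three characters, since N < M_N. *)
move=> jk; have [N nN] := ubnP (j + l * Mprod m k).
have NM := leq_trans nN (ltnW (ltn_Mprod N)).
rewrite !(@psi_prod N) -?big_split//=; first last.
- by rewrite (leq_ltn_trans _ NM)// leq_addr.
- by rewrite (leq_ltn_trans _ NM)// leq_addl.
apply: eq_bigr => i _; rewrite -exprD; congr (_ ^+ _).
case: (ltnP i k) => ik; first by rewrite digitMD_low// digitM_low// addn0.
by rewrite digitMD_high// (digit_ge (leq_trans jk (leq_Mprod ik))).
Qed.

Lemma psi_low s j x : (forall i, (i < s)%N -> x i = 0) -> (j < Mprod m s)%N ->
  psi R j x = 1.
Proof.
move=> xs /psi_prod->; rewrite big1// => i _.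
by rewrite rademacher0 ?expr1n// xs.
Qed.

Lemma psi_digit i k x : (i < m k)%N -> psi R (i * Mprod m k) x = rademacher R k x ^+ i.
Proof.
move=> ik; rewrite (@psi_prod k.+1); last first.
  by rewrite MprodS mulnC ltn_pmul2l ?Mprod_gt0.
rewrite big_ord_recr /= {2}/digit mulnK ?Mprod_gt0// modn_small// big1 ?mul1r// => l _.
by rewrite digitM_low// expr0.
Qed.

Lemma eq_psi_high s l x y : (forall i, (s <= i)%N -> x i = y i) ->
  psi R (l * Mprod m s) x = psi R (l * Mprod m s) y.
Proof.
move=> xy; rewrite /psi; apply: eq_bigr => i _.
case: (leqP s i) => si; first by rewrite /rademacher xy.
by rewrite digitM_low// !expr0.
Qed.

Definition dirichlet J x : R[i] := \sum_(k < J) psi R k x.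

Lemma dirichletS J x : dirichlet J.+1 x = dirichlet J x + psi R J x.
Proof. exact: big_ord_recr. Qed.

Lemma norm_dirichlet_le J x : `|dirichlet J x| <= J%:R.
Proof.
rewrite (le_trans (ler_norm_sum _ _ _))//.
by rewrite (eq_bigr (fun=> 1)) ?sumr_const ?card_ord// => k _; rewrite norm_psi.
Qed.

(** The j characters from index l M_k on are psi_(l M_k) times psi_0, ..., psi_(j-1). *)
Lemma dirichletD l k j x : (j <= Mprod m k)%N ->
  dirichlet (l * Mprod m k + j) x =
  dirichlet (l * Mprod m k) x + psi R (l * Mprod m k) x * dirichlet j x.
Proof.
elim: j => [|j IH] jM; first by rewrite addn0 /dirichlet big_ord0 mulr0 addr0.
rewrite addnS !dirichletS IH 1?ltnW// -addrA mulrDr; congr (_ + (_ + _)).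
by rewrite addnC psi_split// mulrC.
Qed.

Lemma dirichletM l k x :
  dirichlet (l * Mprod m k) x =
  dirichlet (Mprod m k) x * \sum_(i < l) psi R (i * Mprod m k) x.
Proof.
elim: l => [|l IH]; first by rewrite mul0n /dirichlet !big_ord0 mulr0.
by rewrite mulSnr dirichletD// IH big_ord_recr mulrDr [X in _ + X]mulrC.
Qed.

Lemma dirichlet_low s J x : (forall i, (i < s)%N -> x i = 0) ->
  (J <= Mprod m s)%N -> dirichlet J x = J%:R.
Proof.
move=> xs JM; rewrite /dirichlet (eq_bigr (fun=> 1)) ?sumr_const ?card_ord// => k _.
by rewrite (psi_low xs)// (leq_trans _ JM).
Qed.

(** D_(M_(s+1)) has the geometric sum of the first m_s powers of r_s(x) as a factor, and r_s(x) is
    an m_s-th root of unity other than 1. *)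
Lemma dirichlet_Mprod_eq0 s l x : x s != 0 -> dirichlet (l * Mprod m s.+1) x = 0.
Proof.
move=> xs; rewrite dirichletM MprodS mulnC dirichletM.
set S := \sum_(i < m s) _; suff -> : S = 0 by rewrite mulr0 mul0r.
have r1 : rademacher R s x - 1 != 0 by rewrite subr_eq0 rademacher_neq1.
apply: (mulfI r1); rewrite mulr0.
have := subrX1 (rademacher R s x) (m s); rewrite rademacherXm subrr => ->.
by congr (_ * _); apply: eq_bigr => i _; rewrite psi_digit.
Qed.

Lemma dirichlet_mod s J x : x s != 0 ->
  dirichlet J x = psi R (J %/ Mprod m s.+1 * Mprod m s.+1) x *
    dirichlet (J %% Mprod m s.+1) x.
Proof.
move=> xs; rewrite [in LHS](divn_eq J (Mprod m s.+1)) dirichletD; last first.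
  by rewrite ltnW// ltn_mod Mprod_gt0.
by rewrite dirichlet_Mprod_eq0// add0r.
Qed.

Lemma norm_dirichlet_block s J x : x s != 0 -> `|dirichlet J x| <= (Mprod m s.+1)%:R.
Proof.
move=> xs; rewrite (dirichlet_mod _ xs) normrM norm_psi mul1r.
rewrite (le_trans (norm_dirichlet_le _ _))// ler_nat ltnW// ltn_mod.
exact: Mprod_gt0.
Qed.

(* M_{s+1} times this sum is a Dirichlet kernel at the point obtained from x by
   erasing its first s + 1 coordinates. *)
Lemma norm_sum_psi_multiples s r l x : (s < r)%N ->
  (forall i, (s < i < r)%N -> x i = 0) ->
  (x r != 0) || (l * Mprod m s.+1 <= Mprod m r.+1)%N ->
  `|\sum_(i < l) psi R (i * Mprod m s.+1) x| * (Mprod m s.+1)%:R <= (Mprod m r.+1)%:R.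
Proof.
move=> sr xz xr.
pose y : vilenkin m := fun i => if (s < i)%N then x i else 0.
have -> : \sum_(i < l) psi R (i * Mprod m s.+1) x = \sum_(i < l) psi R (i * Mprod m s.+1) y.
  by apply: eq_bigr => i _; apply: eq_psi_high => j sj; rewrite /y sj.
have -> : (Mprod m s.+1)%:R = `|dirichlet (Mprod m s.+1) y|.
  rewrite (@dirichlet_low s.+1)// ?normr_nat// => i; rewrite ltnS /y => si.
  by rewrite ltnNge si.
rewrite -normrM mulrC -dirichletM; case/orP: xr => xr.
  by apply: norm_dirichlet_block; rewrite /y sr.
by rewrite (le_trans (norm_dirichlet_le _ _))// ler_nat.
Qed.

(** An unnormalised Fejer kernel; the term j = 0 is zero. *)
Definition dirichlet_sum J x : R[i] := \sum_(j < J) dirichlet j x.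

(** Cut J into blocks of length M = M_(s+1). Since D_(lM+j) = psi_(lM) D_j, the complete blocks give
    the first block, at most M^2, times a sum of psi_(iM), at most M_(r+1) / M. The incomplete block
    adds at most M^2 <= M M_(r+1). The alternative on J serves points whose coordinate r is
    unknown. *)
Lemma norm_dirichlet_sum s r J x : (s < r)%N -> x s != 0 ->
  (forall i, (s < i < r)%N -> x i = 0) ->
  (x r != 0) || (J <= Mprod m r.+1)%N ->
  `|dirichlet_sum J x| <= 2 * (Mprod m s.+1)%:R * (Mprod m r.+1)%:R.
Proof.
move=> sr xs xz xr; set M := Mprod m s.+1.
have sumM l : dirichlet_sum (l * M) x =
    dirichlet_sum M x * \sum_(i < l) psi R (i * M) x.
  rewrite /dirichlet_sum; elim: l => [|l IH].
    by rewrite mul0n !big_ord0 mulr0.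
  rewrite mulSnr big_split_ord /= IH big_ord_recr mulrDr; congr (_ + _).
  rewrite mulr_suml; apply: eq_bigr => j _.
  by rewrite dirichletD 1?ltnW// dirichlet_Mprod_eq0// add0r mulrC.
(* The free starting point j0 lets this serve both the first block and the incomplete last one. *)
have sum_le n j0 : `|\sum_(j < n) dirichlet (j0 + j) x| <= n%:R * M%:R.
  rewrite (le_trans (ler_norm_sum _ _ _))// mulr_natl.
  rewrite -[X in _ *+ X]card_ord -sumr_const ler_sum// => j _.
  exact: norm_dirichlet_block.
have JM : (J %/ M * M <= J)%N by rewrite leq_divM.
rewrite {1}(divn_eq J M) /dirichlet_sum big_split_ord /=.
have -> : 2 * M%:R * (Mprod m r.+1)%:R =
    M%:R * (Mprod m r.+1)%:R + (Mprod m r.+1)%:R * M%:R :> R[i].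
  by rewrite -mulrA mulr_natl mulr2n [X in _ + X]mulrC.
rewrite (le_trans (ler_normD _ _))// lerD//.
  rewrite -/(dirichlet_sum _ x) sumM normrM.
  have h : `|\sum_(i < J %/ M) psi R (i * M) x| * M%:R <= (Mprod m r.+1)%:R.
    apply: norm_sum_psi_multiples => //.
    by case/orP: xr => [->//|h]; rewrite (leq_trans JM h) orbT.
  have h0 := sum_le M 0%N.
  rewrite (le_trans (ler_wpM2r (normr_ge0 _) h0))//.
  by rewrite -mulrA ler_wpM2l// mulrC.
rewrite (le_trans (sum_le _ _))// ler_wpM2r// ler_nat.
rewrite (leq_trans _ (leq_Mprod (_ : s.+1 <= r.+1)%N))// ?ltnS 1?ltnW//.
by rewrite -/M ltn_mod Mprod_gt0.
Qed.

End characters.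

(** * The Noerlund kernel *)

Section summation_by_parts.
Variables (K : numDomainType) (q d : nat -> K) (B : K) (N : nat).
Hypothesis q_ge0 : forall j, 0 <= q j.
Hypothesis q_noninc : forall j, q j.+1 <= q j.
Hypothesis sum_d : forall J, (J <= N)%N -> `|\sum_(j < J) d j| <= B.

(** Abel summation: the weights q_j - q_(j+1), j < N, and q_N are nonnegative and add up to q_0. *)
Lemma norm_sum_nonincreasing : `|\sum_(j < N) q j * d j| <= q 0%N * B.
Proof.
(* With the boundary term subtracted the induction telescopes; the term is added back at the end. *)
have step n : (n <= N)%N ->
    `|\sum_(j < n) q j * d j - q n * \sum_(j < n) d j| <= (q 0%N - q n) * B.
  elim: n => [|n IH] nN; first by rewrite !big_ord0 mulr0 !subrr normr0 mul0r.
  have -> : \sum_(j < n.+1) q j * d j - q n.+1 * \sum_(j < n.+1) d j =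
      (\sum_(j < n) q j * d j - q n * \sum_(j < n) d j) +
      (q n - q n.+1) * \sum_(j < n.+1) d j.
    by rewrite !big_ord_recr /=; ring.
  have -> : (q 0%N - q n.+1) * B = (q 0%N - q n) * B + (q n - q n.+1) * B by ring.
  rewrite (le_trans (ler_normD _ _))// lerD ?IH 1?ltnW//.
  have qn : 0 <= q n - q n.+1 by rewrite subr_ge0.
  by rewrite normrM ger0_norm// ler_wpM2l// sum_d.
rewrite -[X in `|X|](subrK (q N * \sum_(j < N) d j)).
have -> : q 0%N * B = (q 0%N - q N) * B + q N * B by ring.
rewrite (le_trans (ler_normD _ _))// lerD ?step//.
by rewrite normrM ger0_norm// ler_wpM2l// sum_d.
Qed.

End summation_by_parts.

Section norlund_kernel.
Variables (R : realType) (m : nat -> nat) (q : R^nat).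
Hypothesis m_ge2 : forall k, (2 <= m k)%N.
Hypothesis q_ge0 : forall k, 0 <= q k.
Hypothesis q_noninc : nonincreasing_seq q.
Implicit Type x : vilenkin m.

(** Q_N times the usual kernel, indexed by j = N - k so that the weights do not increase along the
    sum. *)
Definition norlund_kernel N x : R[i] :=
  \sum_(j < N) (q j)%:C * dirichlet R (N - j) x.

Lemma norm_norlund_kernel_le N x :
  `|norlund_kernel N x| <= (N%:R * Qsum q N)%:C.
Proof.
rewrite (le_trans (ler_norm_sum _ _ _))// /Qsum big_mkord rmorphM rmorph_nat.
rewrite rmorph_sum mulr_sumr ler_sum// => j _.
rewrite normrM ger0_norm ?ler0c// mulrC ler_wpM2r ?ler0c//.
by rewrite (le_trans (norm_dirichlet_le _ _ _))// ler_nat leq_subr.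
Qed.

(** D_(M_n) vanishes at x because M_(s+1) divides M_n, so D_(M_n - j) is minus the sum of the last j
    characters. *)
Lemma norm_dirichlet_subr s n j x : (s < n)%N -> x s != 0 -> (j <= Mprod m n)%N ->
  `|dirichlet R (Mprod m n - j) x| <= j%:R.
Proof.
move=> sn xs jM; have : dirichlet R (Mprod m n) x = 0.
  by have /dvdnP[l ->] := dvdn_Mprod m sn; rewrite dirichlet_Mprod_eq0.
rewrite -{1}(subnK jM) {1}/dirichlet big_split_ord /= -/(dirichlet R (Mprod m n - j) x) => /eqP.
rewrite addr_eq0 => /eqP ->; rewrite normrN (le_trans (ler_norm_sum _ _ _))//.
by rewrite (eq_bigr (fun=> 1)) ?sumr_const ?card_ord// => k _; rewrite norm_psi.
Qed.

(** The value r = n stands for a point with no second nonzero coordinate below n, which is why x_r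
    is constrained only for r < n. *)
Lemma norm_norlund_kernel s r n x : (s < r <= n)%N -> x s != 0 ->
  (forall i, (s < i < r)%N -> x i = 0) -> ((r < n)%N -> x r != 0) ->
  `|norlund_kernel (Mprod m n) x| <=
  (\sum_(j < Mprod m s) j%:R * q j +
   4 * q (Mprod m s) * (Mprod m s.+1)%:R * (Mprod m r.+1)%:R)%:C.
Proof.
move=> /andP[sr rn] xs xz xr; have sn := leq_trans sr rn.
have MsM := leq_Mprod m_ge2 (ltnW sn).
have splitM (F : nat -> R[i]) : \sum_(j < Mprod m n) F j =
    \sum_(j < Mprod m s) F j + \sum_(j < Mprod m n - Mprod m s) F (Mprod m s + j)%N.
  by rewrite -[in LHS](subnKC MsM) big_split_ord.
rewrite /norlund_kernel (splitM (fun j => (q j)%:C * dirichlet R (Mprod m n - j) x)) rmorphD.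
rewrite (le_trans (ler_normD _ _))// lerD//.
  rewrite (le_trans (ler_norm_sum _ _ _))// rmorph_sum ler_sum// => j _.
  rewrite normrM ger0_norm ?ler0c// mulrC rmorphM rmorph_nat ler_wpM2r ?ler0c//.
  by rewrite (norm_dirichlet_subr sn)// (leq_trans _ MsM)// ltnW.
set M := (_ - _)%N; pose B : R := 4 * (Mprod m s.+1)%:R * (Mprod m r.+1)%:R.
rewrite [leRHS](_ : _ = (q (Mprod m s + 0)%N)%:C * B%:C); last first.
  by rewrite -rmorphM /= addn0 /B; congr (_ %:C); ring.
apply: (@norm_sum_nonincreasing _ (fun j => (q (Mprod m s + j)%N)%:C)
  (fun j => dirichlet R (Mprod m n - (Mprod m s + j)) x)).
- by move=> j; rewrite ler0c.
- by move=> j; rewrite lecR q_noninc// leq_add2l.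
move=> J JM.
have Ds_le A : (A <= Mprod m n)%N ->
    `|dirichlet_sum R A x| <= 2 * (Mprod m s.+1)%:R * (Mprod m r.+1)%:R.
  move=> AM; apply: norm_dirichlet_sum => //.
  (* For r = n the bound A <= M_n <= M_(r+1) replaces the information on x_r. *)
  move: rn; rewrite leq_eqVlt => /orP[/eqP rn|/xr->//].
  by rewrite (leq_trans AM) ?orbT// leq_Mprod// rn.
have Ms0 : (0 < Mprod m s)%N by exact: Mprod_gt0.
(* The indices run from M down to M - J + 1, hence a difference of two partial sums. Each costs 2
   M_(s+1) M_(r+1), which makes the factor 4; M + 1 <= M_n holds because M_s >= 1. *)
have -> : \sum_(j < J) dirichlet R (Mprod m n - (Mprod m s + j)) x =
    dirichlet_sum R M.+1 x - dirichlet_sum R (M.+1 - J) x.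
  have MJ : (M.+1 - J + J = M.+1)%N by rewrite subnK// ltnW.
  rewrite -[in dirichlet_sum R M.+1 x]MJ /dirichlet_sum big_split_ord /= addrAC subrr add0r.
  rewrite (reindex_inj rev_ord_inj) /=; apply: eq_bigr => j _.
  congr (dirichlet R _ x); rewrite /M; have := ltn_ord j; lia.
rewrite (le_trans (ler_normB _ _))//.
have -> : B%:C = 2 * (Mprod m s.+1)%:R * (Mprod m r.+1)%:R
               + 2 * (Mprod m s.+1)%:R * (Mprod m r.+1)%:R :> R[i].
  by rewrite /B !rmorphM /= !rmorph_nat; ring.
have M1 : (M.+1 <= Mprod m n)%N by rewrite /M; lia.
by rewrite lerD// Ds_le// (leq_trans _ M1)// leq_subr.
Qed.

End norlund_kernel.

(** * Norms and integration *)

Lemma le_poweR (R : realType) (r : R) (x y : \bar R) :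
  0 <= r -> (0 <= x)%E -> (x <= y)%E -> (x `^ r <= y `^ r)%E.
Proof.
move=> r0 x0 xy; apply: gt0_ler_poweR => //; rewrite in_itv/= leey andbT//.
exact: le_trans xy.
Qed.

Section Lnorm_lemmas.
Context d (T : measurableType d) (R : realType).
Variable mu : {measure set T -> \bar R}.
Variable p : R.
Hypothesis p_ge1 : 1 <= p.
Local Open Scope ereal_scope.

Let p_gt0 : (0 < p)%R. Proof. exact: lt_le_trans p_ge1. Qed.
Let p_neq0 : p != 0%R. Proof. by rewrite gt_eqF. Qed.

Lemma le_Lnorm (f g : T -> \bar R) :
  measurable_fun setT f -> measurable_fun setT g ->
  (forall x, `|f x| <= `|g x|) -> 'N[mu]_p%:E[f] <= 'N[mu]_p%:E[g].
Proof.
move=> mf mg fg; rewrite unlock.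
apply: le_poweR; first by rewrite invr_ge0 ltW.
  by apply: integral_ge0 => x _; exact: poweR_ge0.
apply: ge0_le_integral => //.
- by move=> x _; exact: poweR_ge0.
- by apply: (measurableT_comp (measurable_poweR p)); exact: measurableT_comp.
- by apply: (measurableT_comp (measurable_poweR p)); exact: measurableT_comp.
- by move=> x _; apply: le_poweR => //; exact: ltW.
Qed.

Lemma Lnorm_sum (I : Type) (r : seq I) (f : I -> T -> R) :
  (forall i, measurable_fun setT (f i)) ->
  'N[mu]_p%:E[EFin \o (fun x => \sum_(i <- r) f i x)%R] <=
  \sum_(i <- r) 'N[mu]_p%:E[EFin \o f i].
Proof.
move=> mf; elim: r => [|i r IH].
  rewrite big_nil (@eq_Lnorm _ _ _ _ _ _ (cst 0)) ?Lnorm0 ?eqe// => x /=.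
  by rewrite big_nil.
rewrite big_cons (le_trans _ (leeD2l _ IH))//.
rewrite (@eq_Lnorm _ _ _ _ _ _ (EFin \o (f i \+ (fun x => \sum_(i <- r) f i x)%R)%R)).
  by apply: minkowski_EFin => //; exact: measurable_sum.
by move=> x /=; rewrite big_cons.
Qed.

(* Hoelder's inequality against the indicator of E. *)
Lemma integral_mul_indic_le (f : T -> R) (E : set T) :
  measurable_fun setT f -> measurable E ->
  \int[mu]_x (`|f x| * \1_E x)%:E <=
  (\int[mu]_x (`|f x| `^ p * \1_E x)%:E) `^ p^-1 * mu E `^ (1 - p^-1).
Proof.
(* For p = 1 the conjugate exponent is infinite, but the factor mu(E)^0 is 1 and both sides
   agree. *)
move=> mf mE; have [p1|p1] := eqVneq p 1%R.
  rewrite p1 invr1 subrr poweRe0 mule1 poweRe1; last first.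
    by apply: integral_ge0 => x _; rewrite lee_fin mulr_ge0// powR_ge0.
  by under [leRHS]eq_integral do rewrite powRr1//.
have {}p1 : (1 < p)%R by rewrite lt_neqAle eq_sym p1.
have q0 : (0 < 1 - p^-1)%R by rewrite subr_gt0 invf_lt1.
have m1 : measurable_fun setT (\1_E : T -> R) by exact: measurable_indic.
have indX (x : T) (r : R) : r != 0%R -> ((\1_E x : R) `^ r)%R = \1_E x.
  by move=> r0; rewrite indicE; case: (x \in E); rewrite ?powR1// powR0.
have absI (x : T) : `|\1_E x : R|%R = \1_E x by rewrite ger0_norm.
(* The indicator is idempotent, so it is placed in both factors: f 1_E with exponent p and 1_E with
   the conjugate exponent. *)
have := @hoelder _ _ _ mu (f \* \1_E)%R \1_E p (1 - p^-1)^-1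
  (measurable_funM mf m1) m1 p_gt0.
rewrite invr_gt0 q0 invrK addrCA subrr addr0 => /(_ isT erefl).
rewrite Lnorm1 unlock invrK.
under eq_integral => x _.
  rewrite /= -mulrA !normrM absI.
  rewrite (_ : (\1_E x * \1_E x = \1_E x)%R); last by rewrite -expr2 -powR_mulrn// indX.
  over.
move=> /le_trans; apply; rewrite le_eqVlt; apply/orP; left; apply/eqP.
congr (_ `^ _ * _ `^ _).
  apply: eq_integral => x _.
  by rewrite /= normrM absI powRM// indX.
under eq_integral do rewrite /= absI indX ?invr_eq0 ?gt_eqF//.
by rewrite integral_indic// setIT.
Qed.

End Lnorm_lemmas.

Section Lnorm_average.
Context d1 d2 (X : measurableType d1) (Y : measurableType d2) (R : realType).
Variables (mu : {sigma_finite_measure set X -> \bar R})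
  (nu : {finite_measure set Y -> \bar R}).
Local Open Scope ereal_scope.

(* Minkowski's integral inequality for the indicator weight, by Hoelder and Tonelli. *)
Lemma Lnorm_integral_indic (p : R) (g : X * Y -> R) (E : set Y) (W : \bar R) :
  (1 <= p)%R -> measurable_fun setT g -> measurable E -> 0 <= W ->
  (forall y, E y -> Lnorm mu p%:E (fun x => (g (x, y))%:E) <= W) ->
  Lnorm mu p%:E (fun x => \int[nu]_y (`|g (x, y)| * \1_E y)%:E) <= nu E * W.
Proof.
move=> p1 mg mE W0 gW; have p0 : (0 < p)%R by exact: lt_le_trans p1.
have pn0 : p != 0%R by rewrite gt_eqF.
have nuE : nu E \is a fin_num by exact: fin_num_measure.
pose a := fine (nu E); have aE : nu E = a%:E by rewrite fineK.
have a0 : (0 <= a)%R by rewrite fine_ge0.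
have m1 : measurable_fun setT (fun z : X * Y => \1_E z.2 : R).
  by apply: (measurableT_comp (measurable_indic mE)); exact: measurable_snd.
have mag : measurable_fun setT (fun z => `|g z|%R) by exact: measurableT_comp.
have mpow : measurable_fun setT (fun z => `|g z| `^ p)%R.
  by apply: (measurableT_comp (measurable_powR p)).
have m2 : measurable_fun setT (fun z : X * Y => (`|g z| * \1_E z.2)%:E).
  by apply/measurable_EFinP; exact: measurable_funM.
have m3 : measurable_fun setT (fun z : X * Y => (`|g z| `^ p * \1_E z.2)%:E).
  by apply/measurable_EFinP; exact: measurable_funM.
have nn2 (z : X * Y) : 0 <= (`|g z| * \1_E z.2)%:E by rewrite lee_fin mulr_ge0.
have nn3 (z : X * Y) : 0 <= (`|g z| `^ p * \1_E z.2)%:E.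
  by rewrite lee_fin mulr_ge0// powR_ge0.
pose H (x : X) : \bar R := \int[nu]_y (`|g (x, y)| * \1_E y)%:E.
pose U (x : X) : \bar R := \int[nu]_y (`|g (x, y)| `^ p * \1_E y)%:E.
have H0 x : 0 <= H x.
  by apply: integral_ge0 => y _; exact: (nn2 (x, y)).
have U0 x : 0 <= U x by apply: integral_ge0 => y _; exact: (nn3 (x, y)).
have mH : measurable_fun setT H.
  by exact: (@measurable_fun_fubini_tonelli_F _ _ X Y R nu _ m2 nn2).
have mU : measurable_fun setT U by exact: (@measurable_fun_fubini_tonelli_F _ _ X Y R nu _ m3 nn3).
(* Hoelder in y, raised to the power p: the exponent (1 - 1/p) p is p - 1. *)
have HU x : `|H x| `^ p <= U x * (a `^ (p - 1))%:E.
  rewrite gee0_abs//.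
  have mgx : measurable_fun setT (fun y => g (x, y)) by exact: measurable_fun_pair2.
  have /(le_poweR (ltW p0) (H0 x)) := integral_mul_indic_le nu p1 mgx mE.
  rewrite -/(U x) poweRM ?poweR_ge0// -!poweRrM mulVf// poweRe1//.
  by rewrite mulrBl mul1r mulVf// -poweR_EFin -aE.
have IH : \int[mu]_x `|H x| `^ p <= (a%:E * W) `^ p.
  apply: (@le_trans _ _ (\int[mu]_x (U x * (a `^ (p - 1))%:E))).
    apply: ge0_le_integral => //.
    - by move=> x _; exact: poweR_ge0.
    - by apply: (measurableT_comp (measurable_poweR p)); exact: measurableT_comp.
    - by apply: emeasurable_funM.
  rewrite ge0_integralZr ?lee_fin ?powR_ge0//.
  (* After Tonelli the inner integral is at most W^p for y in E and zero elsewhere, for a total of a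
     W^p a^(p-1) = (a W)^p. *)
  have -> : \int[mu]_x U x = \int[nu]_y \int[mu]_x (`|g (x, y)| `^ p * \1_E y)%:E.
    exact: (@fubini_tonelli _ _ _ _ _ mu nu
      (fun z : X * Y => (`|g z| `^ p * \1_E z.2)%:E)).
  rewrite poweRM ?lee_fin// poweR_EFin -(mulr_powRB1 a0 p0) EFinM.
  rewrite muleAC lee_wpmul2r ?lee_fin ?powR_ge0// muleC.
  rewrite -aE -[in leRHS](setIT E) -(integral_indic nu measurableT mE).
  rewrite -ge0_integralZl ?poweR_ge0//; last first.
    by apply/measurable_EFinP; exact: measurable_indic.
  apply: ge0_le_integral => //.
  - by move=> y _; apply: integral_ge0 => x _; exact: (nn3 (x, y)).
  - exact: (@measurable_fun_fubini_tonelli_G _ _ X Y R mu _ m3 nn3).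
  - apply: emeasurable_funM => //.
    by apply/measurable_EFinP; exact: measurable_indic.
  move=> y _; have [yE|yE] := boolP (y \in E); last first.
    rewrite indicE (negbTE yE) mule0.
    by under eq_integral do rewrite mulr0; rewrite integral0.
  rewrite indicE yE mule1; under eq_integral do rewrite mulr1 -poweR_EFin -abse_EFin.
  rewrite -poweR_Lnorm//; apply: le_poweR; [exact: ltW|exact: Lnorm_ge0|].
  by apply: gW; move: yE; rewrite inE.
rewrite unlock (le_trans (le_poweR _ _ IH))//.
- by rewrite invr_ge0 ltW.
- by apply: integral_ge0 => x _; exact: poweR_ge0.
- rewrite -poweRrM mulfV// poweRe1 ?aE//.
  by rewrite mule_ge0.
Qed.

End Lnorm_average.

Section complex_valued_functions.
Context d (T : measurableType d) (R : realType).
Implicit Types (h k : T -> R[i]) (z w : R[i]).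
Local Notation normc := (@Normc.normc R).

Lemma normc_ge0 z : 0 <= normc z.
Proof. by rewrite -ler0c; exact: (normr_ge0 z). Qed.

(** The norm of the field R[i] is itself complex-valued, while [normc] is real; estimates pass from
    one to the other here. *)
Lemma normc_le (a : R) z : (`|z| <= a%:C) = (normc z <= a).
Proof. exact: lecR. Qed.

Lemma normrRe_le z : `|complex.Re z| <= normc z.
Proof. by case: z => a b /=; rewrite -sqrtr_sqr ler_wsqrtr// lerDl sqr_ge0. Qed.

Lemma normrIm_le z : `|complex.Im z| <= normc z.
Proof. by case: z => a b /=; rewrite -sqrtr_sqr ler_wsqrtr// lerDr sqr_ge0. Qed.

Definition cmeasurable h :=
  measurable_fun setT (fun x => complex.Re (h x)) /\
  measurable_fun setT (fun x => complex.Im (h x)).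

Lemma cmeasurable_cst z : cmeasurable (fun=> z).
Proof. by split; exact: measurable_cst. Qed.

Lemma cmeasurableD h k : cmeasurable h -> cmeasurable k ->
  cmeasurable (fun x => h x + k x).
Proof.
move=> [hr hi] [kr ki]; split.
  rewrite (_ : (fun x => _) = (fun x => complex.Re (h x) + complex.Re (k x))).
    exact: measurable_funD.
  by apply/funext => x; case: (h x) (k x) => [? ?] [? ?].
rewrite (_ : (fun x => _) = (fun x => complex.Im (h x) + complex.Im (k x))).
  exact: measurable_funD.
by apply/funext => x; case: (h x) (k x) => [? ?] [? ?].
Qed.

Lemma cmeasurableM h k : cmeasurable h -> cmeasurable k ->
  cmeasurable (fun x => h x * k x).
Proof.
move=> [hr hi] [kr ki]; split.
  rewrite (_ : (fun x => _) = (fun x => complex.Re (h x) * complex.Re (k x) -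
      complex.Im (h x) * complex.Im (k x))).
    by apply: measurable_funB; exact: measurable_funM.
  by apply/funext => x; case: (h x) (k x) => [? ?] [? ?].
rewrite (_ : (fun x => _) = (fun x => complex.Re (h x) * complex.Im (k x) +
    complex.Im (h x) * complex.Re (k x))).
  by apply: measurable_funD; exact: measurable_funM.
by apply/funext => x; case: (h x) (k x) => [? ?] [? ?].
Qed.

Lemma cmeasurableN h : cmeasurable h -> cmeasurable (fun x => - h x).
Proof.
move=> mh; rewrite (_ : (fun x => _) = (fun x => -1 * h x)).
  exact: cmeasurableM (cmeasurable_cst _) mh.
by apply/funext => x; rewrite mulN1r.
Qed.

Lemma cmeasurableJ h : cmeasurable h -> cmeasurable (fun x => (h x)^*).
Proof.
move=> [hr hi]; split.
  rewrite (_ : (fun x => _) = (fun x => complex.Re (h x)))//.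
  by apply/funext => x; case: (h x).
rewrite (_ : (fun x => _) = (fun x => - complex.Im (h x))).
  exact: measurableT_comp.
by apply/funext => x; case: (h x).
Qed.

Lemma cmeasurable_sum (I : Type) (r : seq I) (h : I -> T -> R[i]) :
  (forall i, cmeasurable (h i)) -> cmeasurable (fun x => \sum_(i <- r) h i x).
Proof.
move=> mh; elim: r => [|i r IH].
  under [X in cmeasurable X]funext => x do rewrite big_nil.
  exact: cmeasurable_cst.
under [X in cmeasurable X]funext => x do rewrite big_cons.
exact: cmeasurableD.
Qed.

Lemma cmeasurable_prod (I : Type) (r : seq I) (h : I -> T -> R[i]) :
  (forall i, cmeasurable (h i)) -> cmeasurable (fun x => \prod_(i <- r) h i x).
Proof.
move=> mh; elim: r => [|i r IH].
  under [X in cmeasurable X]funext => x do rewrite big_nil.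
  exact: cmeasurable_cst.
under [X in cmeasurable X]funext => x do rewrite big_cons.
exact: cmeasurableM.
Qed.

Lemma cmeasurable_comp d' (T' : measurableType d') (phi : T' -> T) h :
  measurable_fun setT phi -> cmeasurable h ->
  measurable_fun setT (fun x => complex.Re (h (phi x))) /\
  measurable_fun setT (fun x => complex.Im (h (phi x))).
Proof.
move=> mphi [hr hi].
by split; [exact: (measurableT_comp hr)|exact: (measurableT_comp hi)].
Qed.

Lemma measurable_normc h : cmeasurable h -> measurable_fun setT (fun x => normc (h x)).
Proof.
(* The square root is written as a power 1/2 to use the measurability of real powers. *)
move=> [hr hi]; rewrite (_ : (fun x => _) =
    (fun x => (complex.Re (h x) ^+ 2 + complex.Im (h x) ^+ 2) `^ 2^-1)).
  apply: (measurableT_comp (measurable_powR _)).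
  by apply: measurable_funD; exact: measurable_funX.
by apply/funext => x; rewrite powR12_sqrt ?addr_ge0 ?sqr_ge0//; case: (h x).
Qed.

Variable mu : {measure set T -> \bar R}.

Definition cintegrable h :=
  cmeasurable h /\ (\int[mu]_x (normc (h x))%:E < +oo)%E.

Lemma cintegrable_normc h : cintegrable h -> mu.-integrable setT (EFin \o (fun x => normc (h x))).
Proof.
move=> [mh ih]; apply/integrableP; split.
  by apply/measurable_EFinP; exact: measurable_normc.
by under eq_integral do rewrite /= ger0_norm ?normc_ge0//.
Qed.

Lemma cintegrable_ReIm h : cintegrable h ->
  mu.-integrable setT (EFin \o ((fun x => complex.Re (h x)))) /\
  mu.-integrable setT (EFin \o ((fun x => complex.Im (h x)))).
Proof.
move=> ih; have inorm := cintegrable_normc ih; case: ih => -[hr hi] _.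
split; apply: (le_integrable _ _ _ inorm) => //.
- exact/measurable_EFinP.
- by move=> x _ /=; rewrite lee_fin (ger0_norm (normc_ge0 _)) normrRe_le.
- exact/measurable_EFinP.
- by move=> x _ /=; rewrite lee_fin (ger0_norm (normc_ge0 _)) normrIm_le.
Qed.

Lemma cintegrableD h k : cintegrable h -> cintegrable k ->
  cintegrable (fun x => h x + k x).
Proof.
move=> [mh ih] [mk ik]; split; first exact: cmeasurableD.
have mnh := measurable_normc mh; have mnk := measurable_normc mk.
apply: le_lt_trans (lte_add_pinfty ih ik).
rewrite -ge0_integralD//; last first.
- exact/measurable_EFinP.
- by move=> x _; rewrite lee_fin normc_ge0.
- exact/measurable_EFinP.
- by move=> x _; rewrite lee_fin normc_ge0.
apply: ge0_le_integral => //.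
- by move=> x _; rewrite lee_fin normc_ge0.
- by apply/measurable_EFinP; exact: measurable_normc (cmeasurableD mh mk).
- by apply/measurable_EFinP; exact: measurable_funD.
- by move=> x _; rewrite lee_fin le_normcD.
Qed.

Lemma cintegrableM_bounded h k (M : R) : cintegrable h -> cmeasurable k ->
  (forall x, normc (k x) <= M) -> cintegrable (fun x => h x * k x).
Proof.
move=> [mh ih] mk kM; split; first exact: cmeasurableM.
have mnh := measurable_normc mh.
(* The sign of M comes from a point of T, so the empty space is treated apart. *)
have M0 (x : T) : 0 <= M by exact: le_trans (normc_ge0 _) (kM x).
have [->|/set0P[x0 _]] := eqVneq [set: T] set0; first by rewrite integral_set0.
apply: (@le_lt_trans _ _ (M%:E * \int[mu]_x (normc (h x))%:E)%E).
  rewrite -ge0_integralZl ?lee_fin ?(M0 x0)//; last first.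
  - by move=> x _; rewrite lee_fin normc_ge0.
  - exact/measurable_EFinP.
  apply: ge0_le_integral => //.
  - by move=> x _; rewrite lee_fin normc_ge0.
  - by apply/measurable_EFinP; exact: measurable_normc (cmeasurableM mh mk).
  - by apply/measurable_EFinP; exact: measurable_funM.
  - by move=> x _; rewrite lee_fin Normc.normcM mulrC ler_wpM2r// normc_ge0.
by rewrite lte_mul_pinfty ?lee_fin ?(M0 x0).
Qed.

Lemma cintegrable_sum (I : Type) (r : seq I) (h : I -> T -> R[i]) :
  (forall i, cintegrable (h i)) -> cintegrable (fun x => \sum_(i <- r) h i x).
Proof.
move=> mh; elim: r => [|i r IH].
  split; first by apply: cmeasurable_sum => i; case: (mh i).
  under eq_integral do rewrite big_nil Normc.normc0.
  by rewrite integral0.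
under [X in cintegrable X]funext => x do rewrite big_cons.
exact: cintegrableD.
Qed.

End complex_valued_functions.

(** * Haar measure *)

Section haar_measure.
Variables (R : realType) (m : nat -> nat).
Implicit Types (x y t : vilenkin m).
Local Notation normc := (@Normc.normc R).

Lemma measurable_coord k (B : set 'Z_(m k)) :
  measurable [set x : vilenkin m | B (x k)].
Proof.
have -> : [set x : vilenkin m | B (x k)] =
    \bigcup_(j in B) [set x : vilenkin m | x k = j].
  by apply/seteqP; split => [x /= xB|x [j /= jB xj]]; [exists (x k)|rewrite xj].
apply: fin_bigcup_measurable; first exact: finite_finset.
by move=> j _; apply: sub_sigma_algebra; exists k, j.
Qed.

Lemma measurable_fun_coord d (T : measurableType d) k (F : 'Z_(m k) -> T) :
  measurable_fun setT (fun x : vilenkin m => F (x k)).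
Proof. by move=> _ A mA; rewrite setTI; exact: (measurable_coord (F @^-1` A)). Qed.

Definition rectangle n (A : forall k, {set 'Z_(m k)}) : set (vilenkin m) :=
  [set x | forall k, (k < n)%N -> x k \in A k].

Lemma measurable_rectangle n A : measurable (rectangle n A).
Proof.
have -> : rectangle n A = \bigcap_(k in `I_n) [set x | x k \in A k].
  by apply/seteqP; split.
apply: fin_bigcap_measurable; first exact: finite_II.
by move=> k _; exact: (measurable_coord [set` A k]).
Qed.

Lemma vilenkinD x y k : (x + y) k = x k + y k.
Proof. by []. Qed.

(** The preimage of the cylinder with coordinate k equal to j is a finite union, over the value a of
    the first summand, of products of cylinders. *)
Lemma measurable_vilenkin_add :
  measurable_fun setT (fun z : vilenkin m * vilenkin m => z.1 + z.2).
Proof.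
apply: (measurability (coord_cylinders (m := m))) => // _ [_ [k [j ->]] <-].
rewrite setTI (_ : _ @^-1` _ = \bigcup_(a in [set: 'Z_(m k)])
    ([set x | x k = a] `*` [set t | t k = j - a])).
  apply: fin_bigcup_measurable; first exact: finite_finset.
  move=> a _; apply: measurableX; first exact: (measurable_coord [set a]).
  exact: (measurable_coord [set (j - a)]).
apply/seteqP; split => [[x t] /= <-|[x t] [a _] [/= xa ta]].
  by exists (x k) => //; split => //=; rewrite addrC addrA addNr add0r.
by rewrite vilenkinD xa ta addrC subrK.
Qed.

Lemma measurable_translation t : measurable_fun setT (fun x => x + t).
Proof. exact: (measurable_fun_pair1 t measurable_vilenkin_add). Qed.

Lemma setI_closed_rectangle :
  setI_closed [set S | exists n A, S = rectangle n A].
Proof.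
move=> _ _ [n [A ->]] [n' [A' ->]]; exists (maxn n n').
(* Both families are padded with full sides up to the larger length. *)
exists (fun k => (if (k < n)%N then A k else [set: 'Z_(m k)]%SET) :&:
                 (if (k < n')%N then A' k else [set: 'Z_(m k)]%SET))%SET.
apply/seteqP; split => [x [xA xA'] k _|x xAA'].
  by rewrite finset.in_setI; apply/andP; split; case: ifPn => [|_];
    [exact: xA|rewrite inE|exact: xA'|rewrite inE].
split => k kn.
  by have := xAA' k; rewrite leq_max kn => /(_ isT); rewrite finset.in_setI => /andP[].
by have := xAA' k; rewrite leq_max kn orbT => /(_ isT); rewrite finset.in_setI => /andP[].
Qed.

Lemma measurable_rectanglesE :
  @measurable _ (vilenkin m) = <<s [set S | exists n A, S = rectangle n A] >>.
Proof.
apply/seteqP; split; last first.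
  apply: smallest_sub; first exact: sigma_algebra_measurable.
  by move=> _ [n [A ->]]; exact: measurable_rectangle.
apply: smallest_sub; first exact: smallest_sigma_algebra.
move=> _ [k [j ->]]; apply: sub_sigma_algebra; exists k.+1.
(* A cylinder at coordinate k is a rectangle of length k + 1 whose only proper side is the last. *)
exists (@dfwith nat (fun i => {set 'Z_(m i)}) (fun i => [set: 'Z_(m i)]%SET) k [set j]%SET).
apply/seteqP; split => [x /= <- i _|x /(_ k (ltnSn k))].
  have [<-|ik] := eqVneq k i; first by rewrite dfwithin inE.
  by rewrite dfwithout// inE.
by rewrite dfwithin inE => /eqP.
Qed.

Variable mu : probability (vilenkin m) R.
Hypothesis mu_haar : is_haar mu.

Lemma haar_rectangle n A :
  mu (rectangle n A) = (\prod_(k < n) (#|A k|%:R / (m k)%:R))%:E.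
Proof. exact: mu_haar. Qed.

Let translation_mfun t : {mfun vilenkin m >-> vilenkin m} :=
  @mfun_Sub _ _ (vilenkin m) (vilenkin m) _ (mem_set (measurable_translation t)).

(* Translations preserve the side lengths of rectangles, which determine mu. *)
Lemma haar_translation t A : measurable A -> mu ((fun x => x + t) @^-1` A) = mu A.
Proof.
move=> mA; apply/esym; pose G := [set S | exists n A, S = rectangle n A].
apply: (@measure_unique _ _ _ G (fun=> setT) measurable_rectanglesE
  setI_closed_rectangle _ _ mu (distribution mu (translation_mfun t))) => //.
- by exists 0%N, (fun i => [set: 'Z_(m i)]%SET); apply/seteqP; split.
- by rewrite bigcup_const.
- move=> _ [n [B ->]].
  transitivity (mu (rectangle n (fun k => [set j | j + t k \in B k]%SET))).
    rewrite [RHS]haar_rectangle; etransitivity; first exact: haar_rectangle.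
    congr EFin; apply: eq_bigr => k _; congr (_%:R / _).
    by rewrite -(card_preimset (B k) (addIr (t k))); apply: eq_card => j; rewrite !inE.
  congr (mu _); apply/seteqP; split => x /= xB k kn; have := xB k kn; rewrite ?inE//.
- by move=> _; rewrite ltey_eq fin_num_measure.
Qed.

Lemma ge0_integral_translation t (f : vilenkin m -> \bar R) :
  measurable_fun setT f -> (forall x, 0 <= f x)%E ->
  (\int[mu]_x f (x + t)%R = \int[mu]_x f x)%E.
Proof.
move=> mf f0.
rewrite -[LHS](ge0_integral_pushforward (measurable_translation t) mu measurableT mf)//.
apply: eq_measure_integral => [|? A mA _]; first exact: measurable_translation.
exact: (haar_translation t mA).
Qed.

Lemma Lnorm_translation t (p : R) (f : vilenkin m -> \bar R) :
  measurable_fun setT f ->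
  Lnorm mu p%:E (fun x => f (x + t)) = Lnorm mu p%:E f.
Proof.
move=> mf; rewrite unlock; congr (_ `^ _)%E.
apply: (@ge0_integral_translation t (fun x => `|f x| `^ p)%E).
  by apply: (measurableT_comp (measurable_poweR p)); exact: measurableT_comp.
by move=> x; exact: poweR_ge0.
Qed.

Lemma cintegral_translation t (h : vilenkin m -> R[i]) : cintegrable mu h ->
  cintegral mu (fun x => h (x + t)) = cintegral mu h.
Proof.
move=> ih; have [iRe iIm] := cintegrable_ReIm ih; case: (ih) => -[mRe mIm] _.
have mt := measurable_translation t.
have it f : measurable_fun setT f -> mu.-integrable setT f ->
    (\int[mu]_x f (x + t)%R = \int[mu]_x f x)%E.
  move=> mf /integrableP[_ fy].
  rewrite -[LHS](integral_pushforward mt (mu := mu) (D := setT) mf)//.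
    by apply: eq_measure_integral => A mA _; exact: (haar_translation t mA).
  apply/integrableP; split; first exact: (measurableT_comp mf).
  rewrite (@ge0_integral_translation t (fun x => `|f x|)%E)//.
  exact: measurableT_comp.
by congr Complex; rewrite /Rintegral; congr fine; apply: it => //;
  exact/measurable_EFinP.
Qed.

End haar_measure.

(** * Fourier analysis *)

Section fourier.
Variables (R : realType) (m : nat -> nat).
Hypothesis m_ge2 : forall k, (2 <= m k)%N.
Implicit Types (x y t : vilenkin m) (f g h : vilenkin m -> R[i]).
Local Notation normc := (@Normc.normc R).

Lemma conjC_real (a : R) : (a%:C)^* = a%:C.
Proof. exact: conjc_real. Qed.

Lemma cmeasurable_psi n : cmeasurable (fun x => psi R n x).
Proof.
apply: cmeasurable_prod => i; pose F (j : 'Z_(m i)) : R[i] :=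
  expi (2 * pi * (nat_of_ord j)%:R / (m i)%:R) ^+ digit m n i.
split; first exact: (measurable_fun_coord (fun j => complex.Re (F j))).
exact: (measurable_fun_coord (fun j => complex.Im (F j))).
Qed.

Lemma cmeasurable_dirichlet J : cmeasurable (fun x => dirichlet R J x).
Proof. by apply: cmeasurable_sum => i; exact: cmeasurable_psi. Qed.

Lemma cmeasurable_norlund_kernel (q : R^nat) N :
  cmeasurable (fun x : vilenkin m => norlund_kernel q N x).
Proof.
apply: cmeasurable_sum => i; apply: cmeasurableM; first exact: cmeasurable_cst.
exact: cmeasurable_dirichlet.
Qed.

Lemma psiB n x y : psi R n (y - x) = psi R n y * (psi R n x)^*.
Proof.
have -> : psi R n y = psi R n (y - x) * psi R n x by rewrite -(psiD R m_ge2) subrK.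
by rewrite -mulrA -sqr_normc norm_psi// expr1n mulr1.
Qed.

Lemma psi_nontrivial n : (0 < n)%N -> exists t, psi R n t != 1.
Proof.
move=> n0; have [i di] : exists i : 'I_n, digit m n i != 0%N.
  apply/existsP; apply: contraLR n0; rewrite negb_exists -eqn0Ngt => /forallP d0.
  rewrite (digit_expansion (ltn_Mprod m_ge2 n)) big1// => i _.
  by have := d0 i; rewrite negbK => /eqP ->; rewrite mul0n.
(* The witness has the single nonzero coordinate 1 at an index i with n_i != 0, where psi_n takes
   the value exp(2 pi i n_i / m_i) with imaginary unit i in the exponent. *)
exists (@dfwith nat (fun k => 'Z_(m k)) (0 : vilenkin m) i 1).
rewrite /psi (bigD1 i)//= big1 ?mulr1.
  rewrite rademacherE// dfwithin expr1 root_neq1//.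
  by rewrite lt0n di /= /digit ltn_mod (ltn_trans _ (m_ge2 i)).
by move=> j ji; rewrite rademacher0 ?expr1n// dfwithout// eq_sym.
Qed.

Variable mu : probability (vilenkin m) R.

Lemma cintegralD g h : cintegrable mu g -> cintegrable mu h ->
  cintegral mu (fun x => g x + h x) = cintegral mu g + cintegral mu h.
Proof.
move=> /cintegrable_ReIm[gr gi] /cintegrable_ReIm[hr hi].
apply/eqP; rewrite eq_complex /= -!RintegralD//.
by apply/andP; split; apply/eqP; apply: eq_Rintegral => x _;
  case: (g x) (h x) => [? ?] [? ?].
Qed.

Lemma cintegralJ h : cintegrable mu h ->
  cintegral mu (fun x => (h x)^*) = (cintegral mu h)^*.
Proof.
move=> /cintegrable_ReIm[hr hi]; apply/eqP; rewrite eq_complex /=.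
apply/andP; split; apply/eqP.
  by apply: eq_Rintegral => x _; case: (h x).
rewrite -mulN1r -RintegralZl//; apply: eq_Rintegral => x _.
by rewrite mulN1r; case: (h x).
Qed.

Lemma cintegralMl (c : R[i]) h : cintegrable mu h ->
  cintegral mu (fun x => c * h x) = c * cintegral mu h.
Proof.
move=> /cintegrable_ReIm[hr hi]; case: c => a b.
have iZ (r : R) u : mu.-integrable setT (EFin \o u) ->
    mu.-integrable setT (EFin \o (fun x => r * u x)).
  by move=> iu; exact: (integrableZl measurableT r iu).
apply/eqP; rewrite eq_complex /=; apply/andP; split; apply/eqP.
  rewrite -!RintegralZl// -RintegralB ?iZ//; apply: eq_Rintegral => x _.
  by case: (h x).
rewrite -!RintegralZl// -RintegralD ?iZ//; apply: eq_Rintegral => x _.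
by case: (h x).
Qed.

Lemma cintegral_sum (I : Type) (r : seq I) (h : I -> vilenkin m -> R[i]) :
  (forall i, cintegrable mu (h i)) ->
  cintegral mu (fun x => \sum_(i <- r) h i x) = \sum_(i <- r) cintegral mu (h i).
Proof.
move=> ih; elim: r => [|i r IH].
  rewrite big_nil (_ : (fun x => _) = (fun=> 0)).
    by rewrite /cintegral /Rintegral integral0.
  by apply/funext => x; rewrite big_nil.
rewrite big_cons -IH -cintegralD//; last exact: cintegrable_sum.
by congr (cintegral mu _); apply/funext => x; rewrite big_cons.
Qed.

Lemma cintegrable_bounded h (M : R) :
  cmeasurable h -> (forall x, normc (h x) <= M) -> cintegrable mu h.
Proof.
move=> mh hM.
have i1 : cintegrable mu (fun=> 1).
  split; first exact: cmeasurable_cst.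
  under eq_integral do rewrite Normc.normc1.
  by rewrite integral_cst// mul1e ltey_eq fin_num_measure.
rewrite (_ : h = (fun x => 1 * h x)); first exact: cintegrableM_bounded hM.
by apply/funext => x; rewrite mul1r.
Qed.

(** With I the integral of h, |I|^2 is the real part of the integral of conj(I) h, hence at most |I|
    times the integral of |h|. *)
Lemma normc_cintegral h : cintegrable mu h ->
  normc (cintegral mu h) <= \int[mu]_x normc (h x).
Proof.
move=> ih; have [hr hi] := cintegrable_ReIm ih; have inorm := cintegrable_normc ih.
set I := cintegral mu h; have [->|I0] := eqVneq I 0.
  by rewrite Normc.normc0 Rintegral_ge0// => x _; exact: normc_ge0.
have nI : 0 < normc I.
  by rewrite lt_neqAle normc_ge0 andbT eq_sym; apply: contraNneq I0 => /Normc.eq0_normc ->.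
have : normc I * normc I = complex.Re (cintegral mu (fun x => I^* * h x)).
  rewrite cintegralMl// -/I [_^* * _]mulrC -sqr_normc.
  by rewrite (_ : `|I| = (normc I)%:C)// -rmorphXn/= expr2.
move=> h1; rewrite -(ler_pM2l nI) h1 -RintegralZl//.
have iI : cintegrable mu (fun x => I^* * h x).
  rewrite (_ : (fun x => _) = (fun x => h x * I^*)).
    by apply: (cintegrableM_bounded ih (cmeasurable_cst _ (I^*))) => x.
  by apply/funext => x; rewrite mulrC.
apply: le_Rintegral => //; first by have [] := cintegrable_ReIm iI.
  exact: (integrableZl measurableT _ inorm).
move=> x _ /=; rewrite (le_trans (ler_norm _))// (le_trans (normrRe_le _))//.
rewrite Normc.normcM ler_wpM2r ?normc_ge0// -normc_le.
by rewrite normcJ.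
Qed.

Hypothesis mu_haar : is_haar mu.

Lemma normc_psi n x : normc (psi R n x) = 1.
Proof. by apply: complexI; exact: (norm_psi R n x). Qed.

Lemma cintegrable_psi n : cintegrable mu (fun x => psi R n x).
Proof.
apply: (@cintegrable_bounded _ 1); first exact: cmeasurable_psi.
by move=> x; rewrite normc_psi.
Qed.

(** Translation by t preserves the integral and also multiplies it by psi_n(t), which differs from 1
    for a suitable t when n > 0. *)
Lemma cintegral_psi n : cintegral mu (fun x => psi R n x) = (n == 0%N)%:R.
Proof.
have [->|n0] := eqVneq n 0%N.
  rewrite (_ : (fun x => _) = (fun=> 1)); last by apply/funext => x; rewrite psi0.
  rewrite /cintegral /= !Rintegral_cst//= mul0r mul1r.
  by rewrite (_ : fine _ = 1)//; have := @probability_setT _ _ _ mu => ->.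
have [|t t1] := @psi_nontrivial n; first by rewrite lt0n.
have := cintegral_translation mu_haar t (cintegrable_psi n).
rewrite (_ : (fun x => psi R n (x + t)) = (fun x => psi R n t * psi R n x)).
  rewrite cintegralMl; last exact: cintegrable_psi.
  move=> /eqP; rewrite -subr_eq0 -[X in _ - X]mul1r -mulrBl mulf_eq0 subr_eq0.
  by rewrite (negbTE t1) => /eqP.
by apply/funext => x; rewrite (psiD R m_ge2); exact: mulrC.
Qed.

Variables (f : vilenkin m -> R[i]).
Hypothesis f_int : cintegrable mu f.

Lemma cintegrable_mul_translate_conj (K : vilenkin m -> R[i]) (M : R) x :
  cmeasurable K -> (forall t, normc (K t) <= M) ->
  cintegrable mu (fun y => f y * (K (y - x))^*).
Proof.
move=> mK KM; apply: (cintegrableM_bounded (M := M) f_int).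
  apply: cmeasurableJ; apply: (cmeasurable_comp (measurable_translation (- x)) mK).
by move=> y; rewrite -normc_le normcJ normc_le.
Qed.

Lemma partial_sumE k x :
  partial_sum mu k f x = cintegral mu (fun y => f y * (dirichlet R k (y - x))^*).
Proof.
have ipsi i : cintegrable mu (fun y => f y * (psi R i (y - x))^*).
  apply: (cintegrable_mul_translate_conj (M := 1) _ (cmeasurable_psi i)) => t.
  by rewrite normc_psi.
rewrite (_ : (fun y => _) = (fun y => \sum_(i < k) f y * (psi R i (y - x))^*)); last first.
  by apply/funext => y; rewrite /dirichlet rmorph_sum mulr_sumr.
rewrite cintegral_sum//; apply: eq_bigr => i _.
rewrite /fourier_coef mulrC -cintegralMl.
  congr (cintegral mu _); apply/funext => y.
  by rewrite psiB rmorphM /= conjCK mulrCA; congr (_ * _); rewrite mulrC.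
apply: (cintegrableM_bounded (M := 1) f_int); first exact/cmeasurableJ/cmeasurable_psi.
by move=> y; rewrite -normc_le normcJ normc_le normc_psi.
Qed.

Lemma norlund_kernel_convolution (q : R^nat) N x : Qsum q N != 0 ->
  (Qsum q N)%:C * norlund mu q N f x =
  cintegral mu (fun y => f y * (norlund_kernel q N (y - x))^*).
Proof.
move=> Q0; rewrite /norlund mulrA -rmorphM mulfV// rmorph1 mul1r.
have idir k : cintegrable mu (fun y => f y * (dirichlet R k (y - x))^*).
  apply: (cintegrable_mul_translate_conj (M := k%:R) _ (cmeasurable_dirichlet k)) => t.
  by rewrite -normc_le rmorph_nat norm_dirichlet_le.
rewrite (_ : (fun y => f y * (norlund_kernel q N (y - x))^*) =
  (fun y => \sum_(j < N) (q j)%:C * (f y * (dirichlet R (N - j) (y - x))^*))).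
  rewrite cintegral_sum => [|j]; last first.
    have [mi ii] := idir (N - j)%N.
    rewrite (_ : (fun y => _) = (fun y => f y * (dirichlet R (N - j) (y - x))^* * (q j)%:C)).
      exact: (cintegrableM_bounded (idir _) (cmeasurable_cst _ _) (fun=> lexx _)).
    by apply/funext => y; rewrite [RHS]mulrC.
  (* The sum over 1 <= k <= N is shifted to start at 0 and then reversed, so that k = N - j. *)
  rewrite big_add1 /= -[N in LHS]subn0 big_mkord (reindex_inj rev_ord_inj) /= subn0.
  apply: eq_bigr => j _; rewrite cintegralMl// -partial_sumE.
  by congr ((q _)%:C * partial_sum mu _ f x); have := ltn_ord j; lia.
apply/funext => y; rewrite /norlund_kernel rmorph_sum mulr_sumr.
by apply: eq_bigr => j _; rewrite rmorphM /= conjC_real mulrCA.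
Qed.

(** Only psi_0 has a nonzero integral, and each D_(N-j) with j < N contains it exactly once. *)
Lemma cintegral_norlund_kernel (q : R^nat) N :
  cintegral mu (fun t => norlund_kernel q N t) = (Qsum q N)%:C.
Proof.
have idir k : cintegrable mu (fun t => dirichlet R k t).
  by apply: cintegrable_sum => i; exact: cintegrable_psi.
rewrite /norlund_kernel cintegral_sum => [|j]; last first.
  rewrite (_ : (fun t => _) = (fun t => dirichlet R (N - j) t * (q j)%:C)).
    exact: (cintegrableM_bounded (idir _) (cmeasurable_cst _ _) (fun=> lexx _)).
  by apply/funext => t; rewrite [RHS]mulrC.
rewrite /Qsum big_mkord rmorph_sum; apply: eq_bigr => j _.
rewrite cintegralMl// /dirichlet cintegral_sum => [|i]; last exact: cintegrable_psi.
have := ltn_ord j; rewrite -subn_gt0; case: (N - j)%N => // k _.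
rewrite big_ord_recl cintegral_psi /= big1 ?addr0 ?mulr1// => i _.
by rewrite cintegral_psi.
Qed.

(** As the kernel has integral Q_N, the number Q_N f(x) is also an integral against conj(K(y - x));
    the difference is the integral of f(y) - f(x) against it, and y = x + t. *)
Lemma norlund_sub_le (q : R^nat) N x : (0 < N)%N -> (forall k, 0 <= q k) ->
  Qsum q N != 0 ->
  ((Qsum q N * normc (norlund mu q N f x - f x))%:E <=
   \int[mu]_t (normc (f (x + t)%R - f x) * normc (norlund_kernel q N t))%:E)%E.
Proof.
move=> N0 q0 Q0; have Q_ge0 : 0 <= Qsum q N by exact: sumr_ge0.
have KM t : normc (norlund_kernel q N t : R[i]) <= N%:R * Qsum q N.
  by rewrite -normc_le; exact: norm_norlund_kernel_le.
have mK := @cmeasurable_norlund_kernel q N.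
have iK : cintegrable mu (fun t => norlund_kernel q N t) by exact: cintegrable_bounded KM.
pose g y := (f y - f x) * (norlund_kernel q N (y - x))^*.
have iKx : cintegrable mu (fun y => (norlund_kernel q N (y - x))^*).
  apply: (cintegrable_bounded (M := N%:R * Qsum q N)).
    by apply: cmeasurableJ; exact: (cmeasurable_comp (measurable_translation (- x)) mK).
  by move=> y; rewrite -normc_le normcJ normc_le.
have ifx : cintegrable mu (fun y => f y - f x).
  apply: cintegrableD => //.
  exact: (cintegrable_bounded (cmeasurable_cst _ _) (fun=> lexx _)).
have ig : cintegrable mu g.
  apply: (cintegrableM_bounded (M := N%:R * Qsum q N) ifx); first by case: iKx.
  by move=> y; rewrite -normc_le normcJ normc_le.
have intg : (Qsum q N)%:C * (norlund mu q N f x - f x) = cintegral mu g.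
  rewrite mulrBr norlund_kernel_convolution//.
  have -> : (Qsum q N)%:C * f x =
      - cintegral mu (fun y => - f x * (norlund_kernel q N (y - x))^*).
    rewrite cintegralMl// mulNr opprK mulrC; congr (_ * _).
    have ikx : cintegrable mu (fun y => norlund_kernel q N (y - x)).
      apply: (cintegrable_bounded (M := N%:R * Qsum q N)) => [|y]; last exact: KM.
      exact: (cmeasurable_comp (measurable_translation (- x)) mK).
    rewrite cintegralJ// (cintegral_translation mu_haar (- x) iK).
    by rewrite cintegral_norlund_kernel conjC_real.
  rewrite opprK -cintegralD.
  - by congr (cintegral mu _); apply/funext => y; rewrite -mulrDl.
  - exact: (cintegrable_mul_translate_conj _ mK KM).
  - rewrite (_ : (fun y => _) = (fun y => (norlund_kernel q N (y - x))^* * - f x)).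
      exact: (cintegrableM_bounded iKx (cmeasurable_cst _ _) (fun=> lexx _)).
    by apply/funext => y; rewrite [RHS]mulrC.
have -> : Qsum q N * normc (norlund mu q N f x - f x) = normc (cintegral mu g).
  rewrite -intg Normc.normcM; congr (_ * _).
  by rewrite /= expr0n/= addr0 sqrtr_sqr ger0_norm.
apply: (@le_trans _ _ (\int[mu]_y (normc (g y))%:E)%E).
  rewrite -[leRHS]fineK ?lee_fin; first exact: normc_cintegral.
  exact: (integrable_fin_num measurableT (cintegrable_normc ig)).
rewrite -(ge0_integral_translation mu_haar x) => [||y].
- rewrite le_eqVlt; apply/orP; left; apply/eqP; apply: eq_integral => t _.
  rewrite /g Normc.normcM addrK [(t + x)%R]addrC; congr (_ * _)%:E.
  by apply: complexI; exact: (normcJ (norlund_kernel q N t)).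
- by apply/measurable_EFinP; apply: measurable_normc; case: ig.
- by rewrite lee_fin normc_ge0.
Qed.

End fourier.

(** * The modulus of continuity *)

Section modulus_of_continuity.
Variables (R : realType) (m : nat -> nat).
Hypothesis m_ge2 : forall k, (2 <= m k)%N.
Implicit Types (x y t : vilenkin m) (f g h : vilenkin m -> R[i]).
Local Notation normc := (@Normc.normc R).

Let M_gt0 k : 0 < (Mprod m k)%:R :> R.
Proof. by rewrite ltr0n Mprod_gt0. Qed.

(* The hypothesis on k0 is needed: |t| = 1 / M_s when all the digits of t from s
   on are maximal. *)
Lemma vabs_lt s k0 t : (s <= k0)%N -> (forall i, (i < s)%N -> t i = 0) ->
  ((t k0).+1 < m k0)%N -> (vabs R t < ((Mprod m s)%:R^-1)%:E)%E.
Proof.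
move=> sk0 ts tk0.
pose u k : R := (nat_of_ord (t k))%:R / (Mprod m k.+1)%:R.
have u0 k : 0 <= u k by rewrite divr_ge0.
have mk k : (Mprod m k)%:R^-1 = (m k)%:R / (Mprod m k.+1)%:R :> R.
  rewrite MprodS natrM invfM mulrCA mulfV ?mulr1//.
  by rewrite pnatr_eq0 -lt0n (ltn_trans _ (m_ge2 k)).
(* A digit is at most m_k - 1, so term k is at most 1/M_k - 1/M_(k+1) and the bounds telescope. The
   digit at k0 is smaller by one more, a gain of 1/M_(k0+1) recorded once k0 has been passed. *)
have sum_u d : \sum_(0 <= k < s + d) u k +
    (k0 < s + d)%N%:R / (Mprod m k0.+1)%:R <=
    (Mprod m s)%:R^-1 - (Mprod m (s + d))%:R^-1.
  elim: d => [|d IH].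
    rewrite addn0 ltnNge sk0 mul0r addr0 subrr big_nat big1// => k /andP[_ ks].
    by rewrite /u ts// mul0r.
  rewrite addnS big_nat_recr//= ltnS leq_eqVlt.
  have uk : u (s + d)%N + (k0 == (s + d)%N)%:R / (Mprod m k0.+1)%:R <=
      (Mprod m (s + d))%:R^-1 - (Mprod m (s + d).+1)%:R^-1.
    rewrite (mk (s + d)%N) -[X in _ - X]mul1r -mulrBl /u.
    have -> : (k0 == (s + d)%N)%:R / (Mprod m k0.+1)%:R =
        (k0 == (s + d)%N)%:R / (Mprod m (s + d).+1)%:R :> R.
      by case: eqP => [->//|_]; rewrite !mul0r.
    rewrite -mulrDl ler_pM2r ?invr_gt0// lerBrDr -natrD natr1 ler_nat.
    case: eqP => [<-|_]; first by rewrite addn1.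
    by rewrite addn0 coord_lt.
  have -> : (((k0 == (s + d)%N) || (k0 < s + d)%N)%:R : R) =
      (k0 == (s + d)%N)%:R + (k0 < s + d)%N%:R.
    by case: ltngtP => //=; rewrite ?addr0 ?add0r.
  rewrite mulrDl; lra.
(* The gain is a fixed positive number, so the strict inequality survives the limit of the partial
   sums. *)
apply: (@le_lt_trans _ _ ((Mprod m s)%:R^-1 - (Mprod m k0.+1)%:R^-1)%:E); last first.
  by rewrite lte_fin ltrBlDr ltrDl invr_gt0.
apply: lime_le; first by apply: is_cvg_nneseries => k _ _; rewrite lee_fin.
near=> N; have k0N : (k0 < N)%N by near: N; exact: nbhs_infty_gt.
rewrite sumEFin lee_fin; have := sum_u (N - s)%N.
rewrite (subnKC (leq_trans sk0 (ltnW k0N))) k0N mul1r.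
have : 0 < (Mprod m N)%:R^-1 :> R by rewrite invr_gt0.
rewrite -/u; lra.
Unshelve. all: by end_near. Qed.

Variable mu : probability (vilenkin m) R.
Hypothesis mu_haar : is_haar mu.
Variable p : R.
Hypothesis p_ge1 : 1 <= p.
Local Open Scope ereal_scope.

Lemma Lpnorm_ge0 f : 0 <= Lpnorm mu p f.
Proof. exact: Lnorm_ge0. Qed.

Lemma Lpnorm_le_add f g h : cmeasurable f -> cmeasurable g -> cmeasurable h ->
  (forall x, normc (f x) <= normc (g x) + normc (h x))%R ->
  Lpnorm mu p f <= Lpnorm mu p g + Lpnorm mu p h.
Proof.
move=> /measurable_normc mf /measurable_normc mg /measurable_normc mh fgh.
apply: (le_trans _ (minkowski_EFin mu mg mh p_ge1)).
apply: le_Lnorm => //.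
- exact/measurable_EFinP.
- by apply/measurable_EFinP; exact: measurable_funD.
- by move=> x; rewrite /= lee_fin !ger0_norm ?addr_ge0 ?normc_ge0.
Qed.

Lemma Lpnorm_translation t f : cmeasurable f ->
  Lpnorm mu p (fun x => f (x + t)%R) = Lpnorm mu p f.
Proof.
move=> /measurable_normc mf.
by apply: (Lnorm_translation mu_haar t p (f := fun x => (normc (f x))%:E)); exact/measurable_EFinP.
Qed.

Variable f : vilenkin m -> R[i].
Hypothesis f_Lp : inLp mu p f.

Let f_meas : cmeasurable f. Proof. by case: f_Lp. Qed.

Lemma cmeasurable_translate t : cmeasurable (fun x => f (x + t)%R).
Proof. exact: (cmeasurable_comp (measurable_translation t) f_meas). Qed.

Lemma cmeasurable_diff t : cmeasurable (fun x => f (x + t) - f x)%R.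
Proof.
by apply: cmeasurableD; [exact: cmeasurable_translate|exact: cmeasurableN].
Qed.

(** On a probability space, Hoelder against the whole space bounds the L^1 norm by the L^p norm. *)
Lemma inLp_cintegrable : cintegrable mu f.
Proof.
split => //; have mf := measurable_normc f_meas.
have := integral_mul_indic_le mu p_ge1 mf measurableT.
rewrite [X in X `^ (1 - _)](_ : _ = 1); last exact: probability_setT.
under eq_integral do rewrite indicT mulr1 ger0_norm ?normc_ge0//.
rewrite poweR_EFin powR1 mule1 => /le_lt_trans; apply.
have [_ _] := f_Lp; rewrite /Lpnorm unlock; congr (_ `^ _ < _).
by apply: eq_integral => x _; rewrite indicT mulr1.
Qed.

Local Notation omega_ s := (omega mu p (Mprod m s)%:R^-1 f).

Lemma Lpnorm_diff_le_omega s k0 t : (s <= k0)%N ->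
  (forall i, (i < s)%N -> t i = 0%R) -> ((t k0).+1 < m k0)%N ->
  Lpnorm mu p (fun x => f (x + t) - f x)%R <= omega_ s.
Proof.
move=> sk0 ts tk0; apply: ereal_sup_ubound; exists t => //=.
exact: vabs_lt ts tk0.
Qed.

(* The factor 2 avoids an exception for the t with |t| = 1 / M_s: t is the sum of
   two elements that have a digit 0, at s + 1 and at s respectively. *)
Lemma Lpnorm_diff_le s t : (forall i, (i < s)%N -> t i = 0%R) ->
  Lpnorm mu p (fun x => f (x + t) - f x)%R <= 2%:E * omega_ s.
Proof.
move=> ts; pose u : vilenkin m := @dfwith nat (fun k => 'Z_(m k)) (0%R : vilenkin m) s (t s).
have us i : i != s -> u i = 0%R by move=> /negbTE si; rewrite /u dfwithout// eq_sym si.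
pose v := (t - u)%R.
have vE i : v i = (t i - u i)%R by [].
have uv x : (x + t = (x + u) + v)%R by rewrite -addrA /v [(u + _)%R]addrC subrK.
have -> : 2%:E * omega_ s = omega_ s + omega_ s by rewrite mule_natl mule2n.
apply: (@le_trans _ _ (Lpnorm mu p (fun x => f (x + u + v) - f (x + u))%R +
    Lpnorm mu p (fun x => f (x + u) - f x)%R)).
  apply: Lpnorm_le_add; [exact: cmeasurable_diff| |exact: cmeasurable_diff|].
    exact: (cmeasurable_comp (measurable_translation u) (cmeasurable_diff v)).
  move=> x; rewrite uv.
  rewrite (_ : f (x + u + v) - f x = (f (x + u + v) - f (x + u)) + (f (x + u) - f x))%R.
    exact: le_normcD.
  by rewrite [RHS]addrA subrK.
apply: leeD.
  rewrite (Lpnorm_translation u (f := fun x => f (x + v) - f x)%R); last exact: cmeasurable_diff.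
  apply: (@Lpnorm_diff_le_omega s s) => // [i si|].
    by rewrite vE ts// us ?ltn_eqF// subr0.
  by rewrite vE /u dfwithin subrr.
apply: (@Lpnorm_diff_le_omega s s.+1) => // [i si|].
  by rewrite us ?ltn_eqF.
by rewrite us ?gtn_eqF.
Qed.

Lemma omega_ge0 s : 0 <= omega_ s.
Proof.
apply: (le_trans _ (@Lpnorm_diff_le_omega s s 0%R _ _ _)) => //.
exact: Lpnorm_ge0.
Qed.

(** Translation invariance bounds the modulus by twice the norm of f. Finiteness lets the final
    estimates be carried out in the reals. *)
Lemma omega_lty s : omega_ s < +oo.
Proof.
have [_ _ fp] := f_Lp; apply: (@le_lt_trans _ _ (Lpnorm mu p f + Lpnorm mu p f)).
  apply: ge_ereal_sup => _ [t _ <-].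
  rewrite -{1}(Lpnorm_translation t f_meas).
  apply: Lpnorm_le_add => //; [exact: cmeasurable_diff|exact: cmeasurable_translate|].
  by move=> x; rewrite (le_trans (le_normcD _ _))// normcN.
exact: lte_add_pinfty.
Qed.

Lemma omega_fin_num s : omega_ s \is a fin_num.
Proof. by rewrite ge0_fin_numE ?omega_ge0// omega_lty. Qed.

Lemma le_omega v s : (v <= s)%N -> omega_ s <= omega_ v.
Proof.
move=> vs; apply: ereal_sup_le => _ [t /= ts <-]; exists t => //=.
rewrite (lt_le_trans ts)// lee_fin lef_pV2 ?posrE//.
by rewrite ler_nat leq_Mprod.
Qed.

End modulus_of_continuity.

(** * The approximation estimate *)

Section Lnorm_kernel_bound.
Variables (R : realType) (m : nat -> nat).
Hypothesis m_ge2 : forall k, (2 <= m k)%N.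
Variable mu : probability (vilenkin m) R.
Hypothesis mu_haar : is_haar mu.
Variable p : R.
Hypothesis p_ge1 : 1 <= p.
Variable q : R^nat.
Hypothesis q_ge0 : forall k, 0 <= q k.
Variable f : vilenkin m -> R[i].
Hypothesis f_Lp : inLp mu p f.
Local Notation normc := (@Normc.normc R).

Lemma Lnorm_scale (h : vilenkin m -> R) (k : R) : 0 <= k -> measurable_fun setT h ->
  (Lnorm mu p%:E (EFin \o (fun x => k * h x)%R) = k%:E * Lnorm mu p%:E (EFin \o h))%E.
Proof.
move=> k0 mh; have p0 : 0 < p by exact: lt_le_trans p_ge1.
have mah : measurable_fun setT (fun x => (`|h x| `^ p)%:E).
  apply/measurable_EFinP; apply: (measurableT_comp (measurable_powR p)).
  exact: measurableT_comp.
rewrite unlock; under eq_integral do rewrite /= normrM (ger0_norm k0) powRM// EFinM.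
rewrite ge0_integralZl ?lee_fin ?powR_ge0//.
rewrite poweRM ?lee_fin ?powR_ge0//; last first.
  by apply: integral_ge0 => x _; rewrite lee_fin powR_ge0.
by rewrite poweR_EFin -powRrM mulfV ?gt_eqF// powRr1.
Qed.

Lemma cmeasurable_norlund N : cmeasurable (fun x => norlund mu q N f x).
Proof.
apply: cmeasurableM; first exact: cmeasurable_cst.
apply: cmeasurable_sum => k; apply: cmeasurableM; first exact: cmeasurable_cst.
apply: cmeasurable_sum => i; apply: cmeasurableM; first exact: cmeasurable_cst.
exact: cmeasurable_psi.
Qed.

(** A pointwise majorant of the kernel by indicators turns the bound of [norlund_sub_le] into a
    combination of integrals of |f(x + t) - f(x)| over the sets U_i; Minkowski's integral inequality
    bounds the norm of each by mu(U_i) W_i. *)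
Lemma Lpnorm_norlund_sub_le (I : Type) (r : seq I) (U : I -> set (vilenkin m))
    (c : I -> R) (W : I -> \bar R) (N : nat) :
  (0 < N)%N -> 0 < Qsum q N ->
  (forall i, measurable (U i)) -> (forall i, 0 <= c i) -> (forall i, 0 <= W i)%E ->
  (forall i t, U i t -> Lpnorm mu p (fun x => f (x + t) - f x)%R <= W i)%E ->
  (forall t, normc (norlund_kernel q N t) <= \sum_(i <- r) c i * \1_(U i) t) ->
  (Lpnorm mu p (fun x => norlund mu q N f x - f x)%R <=
   \sum_(i <- r) (c i / Qsum q N)%:E * (mu (U i) * W i))%E.
Proof.
move=> N0 Q0 mU c0 W0 UW Kc; have f_int := inLp_cintegrable p_ge1 f_Lp.
have [mf _] := f_int.
have mg : measurable_fun setT (fun z : vilenkin m * vilenkin m => normc (f (z.1 + z.2) - f z.1)).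
  have mf1 := cmeasurable_comp (@measurable_vilenkin_add m) mf.
  have mf2 := cmeasurable_comp (@measurable_fst _ _ _ _ : measurable_fun setT
    (fst : vilenkin m * vilenkin m -> vilenkin m)) mf.
  apply: (measurable_normc (h := fun z : vilenkin m * vilenkin m => f (z.1 + z.2) - f z.1)).
  by apply: cmeasurableD; [exact: mf1|exact: cmeasurableN mf2].
pose g (x t : vilenkin m) := normc (f (x + t) - f x).
have g0 x t : 0 <= g x t by exact: normc_ge0.
have mgx x : measurable_fun setT (g x) by exact: (measurable_fun_pair2 x mg).
have mgU x i : measurable_fun setT (fun t => (g x t * \1_(U i) t)%:E).
  by apply/measurable_EFinP; apply: measurable_funM => //; exact: measurable_indic.
have gU0 x i t : (0 <= (g x t * \1_(U i) t)%:E)%E by rewrite lee_fin mulr_ge0.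
pose H i (x : vilenkin m) : \bar R := (\int[mu]_t (g x t * \1_(U i) t)%:E)%E.
(* These integrals are finite at every x because f is integrable, so Minkowski for real-valued
   functions applies to their sum. *)
have H_fin i x : H i x \is a fin_num.
  rewrite ge0_fin_numE; last by apply: integral_ge0 => t _.
  have [_] : cintegrable mu (fun t => f (x + t) - f x).
    apply: cintegrableD; last first.
      exact: (cintegrable_bounded mu (cmeasurable_cst _ _) (fun=> lexx _)).
    split; first exact: (cmeasurable_comp (measurable_fun_pair2 x (@measurable_vilenkin_add m)) mf).
    rewrite (_ : (\int[mu]_t _)%E = (\int[mu]_t (normc (f (t + x)))%:E)%E).
      rewrite (ge0_integral_translation mu_haar x (f := fun t => (normc (f t))%:E)).
      - by have [] := f_int.
      - by apply/measurable_EFinP; exact: measurable_normc.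
      - by move=> t; rewrite lee_fin normc_ge0.
    by apply: eq_integral => t _; rewrite addrC.
  apply: le_lt_trans; apply: ge0_le_integral => //.
    by apply/measurable_EFinP; exact: mgx.
  by move=> t _; rewrite lee_fin ler_piMr.
have H0 i x : (0 <= H i x)%E by apply: integral_ge0 => t _.
have mH i : measurable_fun setT (H i).
  have mz : measurable_fun setT (fun z : vilenkin m * vilenkin m =>
      (normc (f (z.1 + z.2)%R - f z.1) * \1_(U i) z.2)%:E).
    apply/measurable_EFinP; apply: measurable_funM => //.
    by apply: (measurableT_comp (measurable_indic (mU i))); exact: measurable_snd.
  have nz (z : vilenkin m * vilenkin m) :
      (0 <= (normc (f (z.1 + z.2)%R - f z.1) * \1_(U i) z.2)%:E)%E.
    by rewrite lee_fin mulr_ge0// normc_ge0.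
  exact: (@measurable_fun_fubini_tonelli_F _ _ _ _ _ mu _ mz nz).
have mh i : measurable_fun setT (fine \o H i).
  by apply: (measurableT_comp _ (mH i)).
have mch i : measurable_fun setT (fun x => c i / Qsum q N * fine (H i x)).
  exact: (measurable_funM (measurable_cst _) (mh i)).
have mD : measurable_fun setT (fun x => normc (norlund mu q N f x - f x)).
  apply: measurable_normc; apply: cmeasurableD; first exact: cmeasurable_norlund.
  exact: cmeasurableN.
have le_sum x : normc (norlund mu q N f x - f x) <=
    \sum_(i <- r) c i / Qsum q N * fine (H i x).
  rewrite -(ler_pM2l Q0) -lee_fin.
  apply: (le_trans (norlund_sub_le m_ge2 mu_haar f_int x N0 q_ge0 (lt0r_neq0 Q0))).
  apply: (@le_trans _ _ (\int[mu]_t \sum_(i <- r) ((c i)%:E * (g x t * \1_(U i) t)%:E))%E).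
    apply: ge0_le_integral => //.
    - by move=> t _; rewrite lee_fin mulr_ge0// normc_ge0.
    - apply/measurable_EFinP; apply: measurable_funM; first exact: mgx.
      exact: measurable_normc (cmeasurable_norlund_kernel m q N).
    - apply: emeasurable_sum => i; apply: emeasurable_funM => //.
    - move=> t _; under eq_bigr do rewrite -EFinM mulrCA.
      rewrite sumEFin lee_fin -mulr_sumr -/(g x t); apply: ler_wpM2l; first exact: g0.
      exact: Kc.
  rewrite ge0_integral_sum//; last 2 first.
  - by move=> i; apply: emeasurable_funM.
  - by move=> i t _; rewrite mule_ge0// lee_fin.
  under eq_bigr => i _ do rewrite ge0_integralZl// ?lee_fin//.
  rewrite mulr_sumr -sumEFin le_eqVlt; apply/orP; left; apply/eqP.
  apply: eq_bigr => i _; rewrite -/(H i x) mulrA [Qsum q N * _]mulrC divfK ?gt_eqF//.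
  by rewrite EFinM fineK.
apply: (@le_trans _ _ (Lnorm mu p%:E
    (EFin \o (fun x => \sum_(i <- r) c i / Qsum q N * fine (H i x))%R))).
  apply: le_Lnorm => //.
  - exact/measurable_EFinP.
  - apply/measurable_EFinP; apply: measurable_sum => i.
    exact: mch.
  - move=> x /=; rewrite lee_fin ger0_norm ?normc_ge0//.
    by rewrite (le_trans (le_sum x))// ler_norm.
apply: (le_trans (Lnorm_sum mu p_ge1 r mch)).
apply: lee_sum => i _.
have cQ : 0 <= c i / Qsum q N by rewrite divr_ge0// ltW.
rewrite (Lnorm_scale cQ (mh i)); apply: lee_wpmul2l; first by rewrite lee_fin.
rewrite (@eq_Lnorm _ _ _ _ _ _ (fun x => \int[mu]_t (`|g x t| * \1_(U i) t)%:E)%E).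
  exact: (@Lnorm_integral_indic _ _ _ _ _ mu mu p _ _ _ p_ge1 mg (mU i) (W0 i) (UW i)).
move=> x /=; rewrite fineK//; apply: eq_integral => t _.
by rewrite ger0_norm.
Qed.

End Lnorm_kernel_bound.

(** A quantity that is halved at each step before a_s is added has a sum at most twice that of the
    a_s, also under nonincreasing weights. This absorbs the sums over earlier blocks of indices. *)
Lemma sum_halving (K : realFieldType) (e T a : nat -> K) (n : nat) :
  (forall s, 0 <= e s) -> (forall s, e s.+1 <= e s) -> (forall s, 0 <= T s) ->
  T 0%N <= a 0%N -> (forall s, T s.+1 <= T s / 2 + a s.+1) ->
  \sum_(0 <= s < n) e s * T s <= 2 * \sum_(0 <= s < n) e s * a s.
Proof.
move=> e0 eS T0 Ta TS; case: n => [|n]; first by rewrite !big_geq// mulr0.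
(* The extra last term is the reserve that pays for the half carried to the next step. *)
suff : \sum_(0 <= s < n.+1) e s * T s + e n * T n <= 2 * \sum_(0 <= s < n.+1) e s * a s.
  by apply: le_trans; rewrite lerDl mulr_ge0.
elim: n => [|n IH].
  by rewrite !big_nat1 mulr_natl mulr2n lerD// ler_wpM2l.
rewrite big_nat_recr//= [X in _ <= 2 * X]big_nat_recr//= mulrDr.
have h1 := ler_wpM2l (e0 n.+1) (TS n); have h2 := ler_wpM2r (T0 n) (eS n).
rewrite mulrDr mulrA in h1; lra.
Qed.

(** * Coset covering and the estimate at the indices M_n *)

Section norlund_means.
Variables (R : realType) (m : nat -> nat).
Hypothesis m_ge2 : forall k, (2 <= m k)%N.
Variable Rm : R.
Hypothesis m_le : forall k, (m k)%:R <= Rm.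
Variable q : R^nat.
Hypothesis q_ge0 : forall k, 0 <= q k.
Hypothesis q_noninc : nonincreasing_seq q.
Implicit Types (x t : vilenkin m).
Local Notation normc := (@Normc.normc R).
Local Notation M k := ((Mprod m k)%:R : R).

Let M_gt0 k : 0 < M k. Proof. by rewrite ltr0n Mprod_gt0. Qed.
Let m_gt0 k : 0 < (m k)%:R :> R. Proof. by rewrite ltr0n (ltn_trans _ (m_ge2 k)). Qed.
Let Rm_ge2 : 2 <= Rm. Proof. by rewrite (le_trans _ (m_le 0)) ?ler_nat. Qed.
Let Rm_gt0 : 0 < Rm. Proof. by rewrite (lt_le_trans _ Rm_ge2). Qed.
Let MS k : M k.+1 = M k * (m k)%:R. Proof. by rewrite MprodS natrM. Qed.

(** Each of the M_n summands of Q is at least q_(M_n); this is how q_(M_n) enters the denominator of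
    the theorem. *)
Lemma Qsum_ge n : M n * q (Mprod m n) <= Qsum q (Mprod m n).
Proof.
rewrite /Qsum -{1}[Mprod m n]subn0 mulr_natl -sumr_const_nat.
by apply: ler_sum_nat => j /andP[_ jM]; apply: q_noninc; exact: ltnW.
Qed.

(** On the block M_v <= j < M_(v+1) one has j <= m_v M_v and q_j <= q_(M_v), and there are at most
    m_v M_v indices. *)
Lemma sum_index_le s : \sum_(j < Mprod m s) j%:R * q j <=
  Rm ^+ 2 * \sum_(0 <= v < s) M v ^+ 2 * q (Mprod m v).
Proof.
rewrite -(big_mkord xpredT (fun j => j%:R * q j)); elim: s => [|s IH].
  (* As M_0 = 1, only j = 0 is present and its term is zero. *)
  by rewrite /Mprod big_ord0 big_nat1 mul0r big_geq// mulr0.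
rewrite (@big_cat_nat _ _ _ (Mprod m s)) ?leq_Mprod//= big_nat_recr//= mulrDr.
apply: lerD => //.
apply: (@le_trans _ _ (\sum_(Mprod m s <= j < Mprod m s.+1) M s.+1 * q (Mprod m s))).
  apply: ler_sum_nat => j /andP[Mj jM].
  by rewrite ler_pM// ?ler_nat ?q_noninc// ltnW.
rewrite sumr_const_nat -[leLHS]mulr_natr.
apply: (@le_trans _ _ (M s.+1 * q (Mprod m s) * M s.+1)).
  by rewrite ler_wpM2l ?mulr_ge0// ler_nat leq_subr.
have -> : M s.+1 * q (Mprod m s) * M s.+1 = (m s)%:R ^+ 2 * (M s ^+ 2 * q (Mprod m s)).
  by rewrite MS; ring.
by rewrite ler_wpM2r ?mulr_ge0 ?exprn_ge0// lerXn2r ?nnegrE// ltW.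
Qed.

Definition coset_ball n : set (vilenkin m) := rectangle n (fun=> [set 0]%SET).

(** Among the first r coordinates only s is free: for s < r this is the union of m_s cosets of I_r.
    I_r itself is included, which is harmless since the shells only serve as a majorant. *)
Definition coset_shell s r : set (vilenkin m) :=
  rectangle r (fun k => if k == s then [set: 'Z_(m k)]%SET else [set 0]%SET).

Variable mu : probability (vilenkin m) R.
Hypothesis mu_haar : is_haar mu.

Lemma mu_ball n : mu (coset_ball n) = ((M n)^-1)%:E.
Proof.
rewrite haar_rectangle//; congr EFin; rewrite /Mprod natr_prod -prodfV.
by apply: eq_bigr => k _; rewrite cards1 mul1r.
Qed.

Lemma mu_shell s r : (s < r)%N -> mu (coset_shell s r) = ((m s)%:R / M r)%:E.
Proof.
move=> sr; rewrite haar_rectangle// prodf_div; congr EFin; congr (_ / _).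
  rewrite (bigD1 (Ordinal sr))//= eqxx cardsT card_ord Zp_cast// big1 ?mulr1// => k.
  by rewrite -val_eqE /= => /negbTE ->; rewrite cards1.
by rewrite /Mprod natr_prod.
Qed.

(* The shell with indices s < r covers the points whose first two nonzero
   coordinates have indices s and r, or s only and r = n. *)
Lemma norlund_kernel_cover n t :
  normc (norlund_kernel q (Mprod m n) t) <=
  M n * Qsum q (Mprod m n) * \1_(coset_ball n) t +
  \sum_(0 <= s < n) \sum_(s.+1 <= r < n.+1)
    (\sum_(j < Mprod m s) j%:R * q j + 4 * q (Mprod m s) * M s.+1 * M r.+1) *
    \1_(coset_shell s r) t.
Proof.
have Q0 : 0 <= Qsum q (Mprod m n) by exact: sumr_ge0.
have c0 s r : 0 <= \sum_(j < Mprod m s) j%:R * q j +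
    4 * q (Mprod m s) * M s.+1 * M r.+1.
  by rewrite addr_ge0 ?sumr_ge0// => [j _|]; rewrite !mulr_ge0.
have [t0|] := pselect (forall k, (k < n)%N -> t k = 0).
  rewrite [X in _ <= X + _](_ : _ = M n * Qsum q (Mprod m n)).
    rewrite -normc_le (le_trans (norm_norlund_kernel_le q_ge0 _ _))//.
    rewrite lecR lerDl sumr_ge0// => s _; rewrite sumr_ge0// => r _.
    by rewrite mulr_ge0.
  rewrite indicE mem_set ?mulr1// => k kn.
  by rewrite inE; apply/eqP/t0.
move=> /existsNP[k0 /not_implyP[k0n /eqP tk0]].
have ex_s : exists k, (k < n)%N && (t k != 0) by exists k0; rewrite k0n.
pose s := ex_minn ex_s; have /andP[sn ts] : (s < n)%N && (t s != 0).
  by rewrite /s; case: ex_minnP.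
have s_min k : (k < s)%N -> t k = 0.
  rewrite /s; case: ex_minnP => i _ imin ki; apply/eqP; apply: contraLR ki => tk.
  rewrite -leqNgt; case: (ltnP k n) => kn; first by apply: imin; rewrite kn.
  by rewrite (leq_trans _ kn)// (leq_trans (imin s _)) ?sn// ltnW.
(* The index n is a sentinel for points with no second nonzero coordinate below n. *)
have ex_r : exists k, (s < k)%N && ((k == n) || (t k != 0)).
  by exists n; rewrite sn eqxx.
pose r := ex_minn ex_r; have /andP[sr tr] : (s < r)%N && ((r == n) || (t r != 0)).
  by rewrite /r; case: ex_minnP.
have r_min k : (s < k)%N -> ((k == n) || (t k != 0)) -> (r <= k)%N.
  by move=> sk tk; rewrite /r; case: ex_minnP => i _; apply; rewrite sk.
have rn : (r <= n)%N by apply: r_min => //; rewrite eqxx.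
have r_zero k : (s < k < r)%N -> t k = 0.
  move=> /andP[sk kr]; apply/eqP; apply: contraLR kr => tk.
  by rewrite -leqNgt r_min// tk orbT.
have t_shell : t \in coset_shell s r.
  rewrite inE => k kr; case: eqP => [_|/eqP ks]; first by rewrite inE.
  rewrite inE; apply/eqP; move: ks; rewrite neq_ltn => /orP[/s_min//|sk].
  by apply: r_zero; rewrite sk.
have srn : (s < r <= n)%N by rewrite sr.
have trn : (r < n)%N -> t r != 0 by move=> rn'; move: tr; rewrite ltn_eqF.
have := norm_norlund_kernel m_ge2 q_ge0 q_noninc srn ts r_zero trn.
rewrite normc_le => /le_trans; apply.
rewrite ler_wpDl ?mulr_ge0//.
rewrite (bigD1_seq s) ?mem_index_iota ?iota_uniq//=.
rewrite (bigD1_seq r) ?mem_index_iota ?iota_uniq ?sr//=.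
rewrite indicE t_shell mulr1 -addrA lerDl addr_ge0// sumr_ge0// => [i _|i _].
  by apply: mulr_ge0; [exact: c0|].
by rewrite sumr_ge0// => j _; apply: mulr_ge0; [exact: c0|].
Qed.

(** Coefficient times measure of a shell, with r = d + s + 1. The bound is free of d, as m_s / M_r
    <= 1 / M_s and M_(r+1) / M_r = m_r, so summing over r costs only a factor n - s. The blocks v <
    s come from [sum_index_le], the block v = s from the summation by parts. *)
Lemma shell_coef_le s d :
  (\sum_(j < Mprod m s) j%:R * q j +
   4 * q (Mprod m s) * M s.+1 * M (d + s.+1).+1) * ((m s)%:R / M (d + s.+1)) <=
  4 * Rm ^+ 3 * ((\sum_(0 <= v < s.+1) M v ^+ 2 * q (Mprod m v)) / M s).
Proof.
set r := (d + s.+1)%N; set B := \sum_(j < _) _.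
have B0 : 0 <= B by apply: sumr_ge0 => j _; rewrite mulr_ge0.
rewrite big_nat_recr//=; set S := \sum_(0 <= v < s) _.
have S0 : 0 <= S by apply: sumr_ge0 => v _; rewrite mulr_ge0// exprn_ge0.
have BS : B <= Rm ^+ 2 * S by exact: sum_index_le.
have ms0 : (m s)%:R != 0 :> R by rewrite gt_eqF.
have Ms0 : M s != 0 by rewrite gt_eqF.
have Mr0 : M r != 0 by rewrite gt_eqF.
have h1 : B * ((m s)%:R / M r) <= 4 * Rm ^+ 3 * (S / M s).
  apply: (@le_trans _ _ (B * ((m s)%:R / M s.+1))).
    rewrite ler_wpM2l// ler_wpM2l// lef_pV2 ?posrE// ler_nat leq_Mprod//.
    by rewrite /r leq_addl.
  have -> : (m s)%:R / M s.+1 = (M s)^-1 by rewrite MS invfM mulrCA mulfV ?mulr1.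
  rewrite mulrA; apply: ler_wpM2r; first by rewrite invr_ge0 ltW.
  apply: (le_trans BS); apply: ler_wpM2r => //.
  by rewrite [in leRHS]exprS mulrA ler_peMl ?sqr_ge0//; have := Rm_ge2; lra.
have h2 : 4 * q (Mprod m s) * M s.+1 * M r.+1 * ((m s)%:R / M r) <=
    4 * Rm ^+ 3 * (M s ^+ 2 * q (Mprod m s) / M s).
  (* M_(s+1) contributes one m_s, the shell measure another, and M_(r+1) / M_r the factor m_r: hence
     the cube of [Rm]. *)
  have -> : 4 * q (Mprod m s) * M s.+1 * M r.+1 * ((m s)%:R / M r) =
      4 * ((m s)%:R * (m r)%:R * (m s)%:R) * (M s * q (Mprod m s)).
    by rewrite !MS; field.
  have -> : M s ^+ 2 * q (Mprod m s) / M s = M s * q (Mprod m s) by field.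
  rewrite ler_wpM2r ?mulr_ge0// ler_wpM2l// !exprS expr0 mulr1 mulrA.
  by rewrite !ler_pM ?mulr_ge0.
by rewrite mulrDl [(S + _) / _]mulrDl [in leRHS]mulrDr lerD.
Qed.

Variable p : R.
Hypothesis p_ge1 : 1 <= p.
Hypothesis q_gt0 : forall k, 0 < q k.
Variable f : vilenkin m -> R[i].
Hypothesis f_Lp : inLp mu p f.
Local Notation omega_ s := (omega mu p (M s)^-1 f).

(** The constant 16 is the 4 of [shell_coef_le], times 2 from [Lpnorm_diff_le], times 2 from
    [sum_halving]. *)
Lemma Lpnorm_norlund_Mprod_sub_le n :
  (Lpnorm mu p (fun x => norlund mu q (Mprod m n) f x - f x)%R <=
   (2 * fine (omega_ n) + 16 * Rm ^+ 3 / Qsum q (Mprod m n) *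
     \sum_(0 <= s < n) ((n - s)%N%:R * fine (omega_ s)) * (M s * q (Mprod m s)))%:E)%E.
Proof.
set Q := Qsum q (Mprod m n); pose w s := fine (omega_ s).
have omegaE s : omega_ s = (w s)%:E.
  by rewrite fineK// (omega_fin_num m_ge2 mu_haar p_ge1 f_Lp).
have w0 s : 0 <= w s by rewrite fine_ge0// (omega_ge0 m_ge2 mu p f).
have wS s : w s.+1 <= w s.
  by rewrite -lee_fin -!omegaE (le_omega m_ge2 mu p f (leqnSn s)).
have Q0 : 0 < Q by rewrite (lt_le_trans _ (Qsum_ge n))// mulr_gt0.
(* [None] indexes the ball I_n and [Some (s, d)] the shell of s and r = d + s + 1, with d < n -
   s. *)
pose U (i : option (nat * nat)) : set (vilenkin m) :=
  if i is Some (s, d) then coset_shell s (d + s.+1) else coset_ball n.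
pose c (i : option (nat * nat)) : R :=
  if i is Some (s, d) then \sum_(j < Mprod m s) j%:R * q j +
    4 * q (Mprod m s) * M s.+1 * M (d + s.+1).+1 else M n * Q.
pose W (i : option (nat * nat)) : \bar R :=
  if i is Some (s, _) then (2%:E * omega_ s)%E else (2%:E * omega_ n)%E.
pose idx := None :: [seq Some (s, d) | s <- index_iota 0 n, d <- index_iota 0 (n - s)].
have sum_idx (V : nmodType) (F : option (nat * nat) -> V) : \sum_(i <- idx) F i =
    F None + \sum_(0 <= s < n) \sum_(0 <= d < n - s) F (Some (s, d)).
  by rewrite big_cons big_allpairs_dep.
apply: (le_trans (Lpnorm_norlund_sub_le m_ge2 mu_haar p_ge1 q_ge0 f_Lp (r := idx)
  (U := U) (c := c) (W := W) _ Q0 _ _ _ _ _)).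
- exact: Mprod_gt0.
- by case=> [[s d]|]; exact: measurable_rectangle.
- case=> [[s d]|] /=; last by rewrite mulr_ge0// ltW.
  by rewrite addr_ge0 ?sumr_ge0// => [j _|]; rewrite !mulr_ge0.
- by case=> [[s d]|] /=; rewrite mule_ge0// (omega_ge0 m_ge2 mu p f).
- case=> [[s d]|] t Ut /=; apply: (Lpnorm_diff_le m_ge2 mu_haar p_ge1 f_Lp) => i il.
    have := Ut i (leq_trans il (leq_trans (leqnSn s) (leq_addl d s.+1))).
    by rewrite ltn_eqF// inE => /eqP.
  by have := Ut i il; rewrite inE => /eqP.
- move=> t; rewrite sum_idx; apply: (le_trans (norlund_kernel_cover n t)).
  rewrite lerD// ler_sum_nat// => s _.
  by rewrite -{1}[s.+1]add0n big_addn subSS.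
rewrite sum_idx /= mu_ball omegaE.
rewrite (eq_bigr (fun s => (\sum_(0 <= d < n - s) c (Some (s, d)) / Q *
    ((m s)%:R / M (d + s.+1) * (2 * w s)))%:E)) => [|s _]; last first.
  rewrite -sumEFin; apply: eq_bigr => d _.
  by rewrite mu_shell ?leq_addl// omegaE -!EFinM.
rewrite sumEFin -!EFinM -EFinD lee_fin; apply: lerD.
  (* The ball: its coefficient M_n Q cancels against its measure 1 / M_n and the division by Q. *)
  rewrite mulfK ?gt_eqF// mulrA mulfV ?mul1r// gt_eqF//.
(* Passing from s to s + 1 divides the earlier blocks by m_s >= 2, which is the halving required by
   [sum_halving]. *)
pose T s := (\sum_(0 <= v < s.+1) M v ^+ 2 * q (Mprod m v)) / M s.
have T0 s : 0 <= T s.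
  by rewrite divr_ge0 ?sumr_ge0// => v _; rewrite mulr_ge0// exprn_ge0.
apply: (@le_trans _ _ (8 * Rm ^+ 3 / Q * \sum_(0 <= s < n) ((n - s)%N%:R * w s) * T s)).
  rewrite mulr_sumr ler_sum_nat// => s _.
  have -> : 8 * Rm ^+ 3 / Q * ((n - s)%N%:R * w s * T s) =
      \sum_(0 <= d < n - s) 8 * Rm ^+ 3 / Q * (w s * T s).
    by rewrite sumr_const_nat subn0 -[RHS]mulr_natl; ring.
  rewrite ler_sum_nat// => d _.
  have -> : c (Some (s, d)) / Q * ((m s)%:R / M (d + s.+1) * (2 * w s)) =
      2 * w s / Q * (c (Some (s, d)) * ((m s)%:R / M (d + s.+1))) by ring.
  have -> : 8 * Rm ^+ 3 / Q * (w s * T s) = 2 * w s / Q * (4 * Rm ^+ 3 * T s) by ring.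
  rewrite ler_wpM2l ?shell_coef_le// divr_ge0 ?mulr_ge0// ltW//.
have -> : 16 * Rm ^+ 3 / Q = 8 * Rm ^+ 3 / Q * 2 by ring.
rewrite -[leRHS]mulrA ler_wpM2l//.
  by rewrite divr_ge0 ?mulr_ge0 ?exprn_ge0// ltW.
have aE s : M s ^+ 2 * q (Mprod m s) / M s = M s * q (Mprod m s).
  have Ms0 : M s != 0 by rewrite gt_eqF.
  by field.
(* The weights are (n - s) omega_s, nonincreasing in s, and a_s = M_s q_(M_s). *)
apply: sum_halving => //.
- by move=> s; rewrite mulr_ge0.
- by move=> s; rewrite ler_pM// ler_nat leq_sub2l.
- by rewrite /T big_nat1 aE.
- move=> s; rewrite /T big_nat_recr//= mulrDl lerD//.
    rewrite MS invfM mulrA (ler_wpM2l (T0 s))//.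
    by rewrite lef_pV2 ?posrE// ler_nat.
  by rewrite aE.
Qed.

End norlund_means.

(** If q_k = 0 then all later terms vanish and Q never exceeds Q_k. Positivity makes the quotients
    by q_(M_n) meaningful. *)
Lemma nonincreasing_divergent_gt0 (R : realType) (q : R^nat) :
  (forall k, 0 <= q k) -> nonincreasing_seq q ->
  Qsum q n @[n --> \oo] --> +oo -> forall k, 0 < q k.
Proof.
move=> q0 qn Qy k; rewrite lt_neqAle q0 andbT eq_sym; apply/eqP => qk.
have qj j : (k <= j)%N -> q j = 0.
  by move=> kj; apply/eqP; rewrite eq_le q0 andbT -qk qn.
have Qk n : Qsum q n <= Qsum q k.
  rewrite /Qsum; case: (leqP n k) => nk.
    by rewrite [leRHS](@big_cat_nat _ _ _ n)//= lerDl sumr_ge0.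
  rewrite (@big_cat_nat _ _ _ k)//= ?(ltnW nk)// [X in _ + X](_ : _ = 0) ?addr0//.
  by rewrite big_nat big1// => i /andP[ki _]; exact: qj.
have /cvgryPgt/(_ (Qsum q k)) [N _ /(_ N (leqnn N))] := Qy.
by rewrite ltNge Qk.
Qed.

Theorem theorem2 (R : realType) (m : nat -> nat)
    (m_ge2 : forall k, (2 <= m k)%N)
    (m_bounded : has_ubound (range (fun k => (m k)%:R : R)))
    (mu : probability (vilenkin m) R) (mu_haar : is_haar mu)
    (q : R^nat) (q_ge0 : forall k, 0 <= q k) (q0_gt0 : 0 < q 0%N)
    (q_noninc : nonincreasing_seq q)
    (Q_cvgy : Qsum q n @[n --> \oo] --> +oo)
    (p : R) (p_ge1 : 1 <= p) :
  let Rm : R := sup (range (fun k => (m k)%:R : R)) in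
  exists2 C : R, 0 < C &
    forall (f : vilenkin m -> R[i]) (n : nat), inLp mu p f ->
    (Lpnorm mu p (fun x => (norlund mu q (Mprod m n) f x - f x)%R)
     <= (3 * Rm ^+ 2)%:E *
          (\sum_(0 <= s < n.+1)
             ((Mprod m s)%:R / (Mprod m n)%:R)%:E *
             omega mu p ((Mprod m s)%:R^-1) f)
        + C%:E *
          (\sum_(0 <= s < n)
             ((n - s)%N%:R * (Mprod m s)%:R / (Mprod m n)%:R *
              (q (Mprod m s) / q (Mprod m n)))%:E *
             omega mu p ((Mprod m s)%:R^-1) f))%E.
Proof.
move=> Rm.
have m_le k : (m k)%:R <= Rm by apply: ub_le_sup => //; exists k.
have q_gt0 := nonincreasing_divergent_gt0 q_ge0 q_noninc Q_cvgy.
have Rm_ge2 : 2 <= Rm by rewrite (le_trans _ (m_le 0%N)) ?ler_nat.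
have Rm_gt0 : 0 < Rm by rewrite (lt_le_trans _ Rm_ge2).
have M_gt0 k : 0 < (Mprod m k)%:R :> R by rewrite ltr0n Mprod_gt0.
exists (16 * Rm ^+ 3); first by rewrite mulr_gt0// exprn_gt0.
move=> f n f_Lp; pose w s := fine (omega mu p (Mprod m s)%:R^-1 f).
have omegaE s : omega mu p (Mprod m s)%:R^-1 f = (w s)%:E.
  by rewrite fineK// (omega_fin_num m_ge2 mu_haar p_ge1 f_Lp).
have w0 s : 0 <= w s by rewrite fine_ge0// (omega_ge0 m_ge2 mu p f).
apply: (le_trans (Lpnorm_norlund_Mprod_sub_le m_ge2 m_le q_ge0 q_noninc
  mu_haar p_ge1 q_gt0 f_Lp n)).
rewrite (eq_bigr (fun s => ((Mprod m s)%:R / (Mprod m n)%:R * w s)%:E)) => [|s _]; last first.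
  by rewrite omegaE EFinM.
rewrite [X in (_ <= _ + _ * X)%E](eq_bigr (fun s => ((n - s)%N%:R * (Mprod m s)%:R /
    (Mprod m n)%:R * (q (Mprod m s) / q (Mprod m n)) * w s)%:E)) => [|s _]; last first.
  by rewrite omegaE EFinM.
rewrite !sumEFin -!EFinM -EFinD lee_fin lerD//.
  apply: ler_pM; [by []|exact: w0|by move: (Rm) Rm_ge2 => r r_ge2; nra|].
  rewrite big_nat_recr//= mulfV ?gt_eqF// mul1r lerDr sumr_ge0// => s _.
  by rewrite mulr_ge0// divr_ge0.
rewrite -mulrA; apply: ler_wpM2l; first by rewrite mulr_ge0// exprn_ge0// ltW.
rewrite mulr_sumr; apply: ler_sum_nat => s _; rewrite -/(w s).
(* In this form only 1 / Q_(M_n) <= 1 / (M_n q_(M_n)) is left to check. *)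
have -> : (n - s)%N%:R * (Mprod m s)%:R / (Mprod m n)%:R *
    (q (Mprod m s) / q (Mprod m n)) * w s =
    ((Mprod m n)%:R * q (Mprod m n))^-1 *
    ((n - s)%N%:R * w s * ((Mprod m s)%:R * q (Mprod m s))).
  by field; rewrite !gt_eqF.
apply: ler_wpM2r; first by rewrite !mulr_ge0.
have Mq0 : 0 < (Mprod m n)%:R * q (Mprod m n) by rewrite mulr_gt0.
have MQ := Qsum_ge m q_noninc n.
by rewrite lef_pV2 ?posrE// (lt_le_trans Mq0).
Qed.
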